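(* For each $n$ let $q=q(n)$, $r=r(n)>0$, $\sigma^2=\sigma^2(n)>0$, and let $\{X_t\}^{(n)}$ be a continuous-time random walk on $\mathbb{Z}_q^n$ as in the context, with increment vector $Y^{(n)}$ satisfying $\|Y^{(n)}\|_1\le r$, $\|Y^{(n)}\|_\infty<q/2$, each coordinate of variance $\sigma^2/n$, and correlation matrix $\Gamma_n$. Let $\varepsilon\in(0,1)$. (a) Suppose $(Y^{(n)})$ satisfies the Decay Condition and $(\Gamma_n)$ satisfies the Correlation Condition with bounding function $g$. Let $S:=\sup_n\|\Psi_n\|_{\max}$ and $$\alpha:=\inf\{z\ge1:\ 4\varepsilon^2\ge\exp((2+S)g(z))-1\}.$$ If $n\to\infty$, $q\to\infty$ and $r^2/q\to0$, then for $t=t_n=\dfrac{nq^2\log(\alpha n)}{4\pi^2\sigma^2}\Big(1-\dfrac{r^2}{12q}\Big)^{-1}$ we have $d^{(n)}(t_n)\le\varepsilon+o(1)$. (b) If $q\to\infty$, $\log(n)\cdot\sup_{k\neq\ell}|(\Gamma_n)_{k\ell}|\to0$ and $\log(n)\, r^2/q^2\to0$ as $n\to\infty$, then for all sufficiently large $n$, $$t^{(n)}_{\mathrm{mix}}(\varepsilon)\ \ge\ \frac{nq^2}{4\pi^2\sigma^2}\Big(\log n+\log\Big(\frac{\varepsilon^{-1}-1}{5}\Big)\Big).$$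
   Context: Elements of $\mathbb{Z}_q^n$ ($\mathbb{Z}_q=\mathbb{Z}/q\mathbb{Z}$) are represented by $(\mathbb{Z}\cap[-q/2,q/2))^n$. Setup: $\mu$ is a probability measure on $\mathbb{Z}_q^n$ with $\mu(y)=\mu(-y)$ whose support generates $\mathbb{Z}_q^n$; $P(x,y)=\mu(y-x)$ is the (irreducible, symmetric) transition matrix of the discrete-time walk; $Y\in\mathbb{Z}^n$ is a random vector with law $\mu$ viewed in the representatives $(\mathbb{Z}\cap[-q/2,q/2))^n$. Each coordinate of $Y$ has variance $\sigma^2/n$, and $\mathrm{Var}(Y)=\frac{\sigma^2}{n}\Gamma$, with $\Gamma=\Gamma_n$ the correlation matrix; when $\Gamma_n$ is invertible write $\Psi_n=\Gamma_n^{-1}$. $\Phi_Y(\theta)=\mathbb{E}[e^{i\theta\cdot Y}]$ is the characteristic function of $Y$ (real-valued by symmetry). $\{X_t\}$ is the rate-1 continuous-time chain with rate matrix $P-I$, kernel $H_t=e^{t(P-I)}$; $d(t)=\max_x\|H_t(x,\cdot)-\mathrm{Unif}(\mathbb{Z}_q^n)\|_{TV}$ and $t_{\mathrm{mix}}(\varepsilon)=\inf\{t:d(t)\le\varepsilon\}$. For a matrix $M$, $\|M\|_{\max}=\max_{a,b}|M_{ab}|$. Decay Condition: with $\mathcal{L}=\{y\in(\mathbb{Z}\cap[-q/2,q/2))^n:\|2\pi y/q\|_\infty>1/\sqrt q\}$, for every sequence $t=t_n\ge \frac{nq^2\log n}{4\pi^2\sigma^2}$, $\sum_{y\in\mathcal{L}}\exp\big(2t(\Phi_Y(2\pi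 y/q)-1)\big)\to0$ as $n\to\infty$. Correlation Condition for a sequence $(\Gamma_n)$ of invertible $n\times n$ correlation matrices: (i) $\sup_n\|\Psi_n\|_{\max}<\infty$; (ii) letting $\Psi_{n,k}$ be the principal submatrix of the first $k$ rows and columns of $\Psi_n$, partitioned as $\begin{bmatrix}\Psi^{(11)}_{n,k}&\Psi^{(12)}_{n,k}\\\Psi^{(21)}_{n,k}&\Psi^{(22)}_{n,k}\end{bmatrix}$ with $\Psi^{(11)}_{n,k}$ the leading $(k-1)\times(k-1)$ block and $\Psi^{(22)}_{n,k}$ the $(k,k)$ entry, define $a^{(n)}_1=(\Psi_n)_{11}^{-1}$ and $a^{(n)}_k=\big(\Psi^{(22)}_{n,k}-\Psi^{(21)}_{n,k}(\Psi^{(11)}_{n,k})^{-1}\Psi^{(12)}_{n,k}\big)^{-1}$ for $k\ge2$; then there is a monotone decreasing function $g:[1,\infty)\to[0,\infty)$ independent of $n$ with $g(\alpha)\to0$ as $\alpha\to\infty$ such that $\sup_n\sum_{k=1}^n(\alpha n)^{-a_k^{(n)}}\le g(\alpha)$ for all $\alpha\ge1$. *)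

(* Defs.v *)
From HB Require Import structures.
From mathcomp Require Import all_boot all_order all_algebra.
From mathcomp Require Import all_classical all_reals all_analysis.
Set Implicit Arguments. Unset Strict Implicit. Unset Printing Implicit Defensive.
Import Order.TTheory GRing.Theory Num.Theory.
Import numFieldNormedType.Exports.
Local Open Scope ring_scope.
Local Open Scope classical_set_scope.

Section WalkDefs.
Variable R : realType.

(* The group Z_q^n (q >= 2 is assumed wherever used). *)
Definition Vq (q n : nat) := {ffun 'I_n -> 'Z_q}.

Definition rep (q : nat) (a : 'Z_q) : int :=
  if (2 * (a : nat) < q)%N then (a : nat)%:Z else (a : nat)%:Z - q%:Z.
Definition repR (q : nat) (a : 'Z_q) : R := (rep a)%:~R.

Variables (q n : nat).
Implicit Types (mu : {ffun 'I_n -> 'Z_q} -> R).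

Definition expect mu (f : {ffun 'I_n -> 'Z_q} -> R) : R :=
  \sum_(x : {ffun 'I_n -> 'Z_q}) mu x * f x.

Definition meanY mu (i : 'I_n) : R := expect mu (fun x => repR (x i)).
Definition covY mu (i j : 'I_n) : R :=
  expect mu (fun x => (repR (x i) - meanY mu i) * (repR (x j) - meanY mu j)).
Definition varY mu (i : 'I_n) : R := covY mu i i.
Definition corrY mu : 'M[R]_n :=
  \matrix_(i, j) (covY mu i j / Num.sqrt (varY mu i * varY mu j)).

(* characteristic function Phi_Y(theta) = E[exp(i theta.Y)] = E[cos(theta.Y)]
   (real by the symmetry of mu) *)
Definition charfun mu (theta : 'I_n -> R) : R :=
  expect mu (fun x => cos (\sum_i theta i * repR (x i))).

Definition supp_generates mu : Prop :=
  forall S : {pred {ffun 'I_n -> 'Z_q}},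
    0 \in S -> (forall x y, x \in S -> y \in S -> x + y \in S) ->
    (forall x, x \in S -> - x \in S) ->
    (forall x, 0 < mu x -> x \in S) -> forall x, x \in S.

Definition walk_setup (r sigma2 : R) mu : Prop :=
  [/\ (1 < q)%N, 0 < r, 0 < sigma2,
      (forall x, 0 <= mu x) /\ \sum_x mu x = 1 &
      (forall x, mu (- x) = mu x)] /\
  [/\ supp_generates mu,
      (forall x, 0 < mu x -> \sum_i `|repR (x i)| <= r),
      (forall x, 0 < mu x -> forall i, `|repR (x i)| < q%:R / 2) &
      (forall i, varY mu i = sigma2 / n%:R)].

Fixpoint Pk mu (k : nat) (x y : {ffun 'I_n -> 'Z_q}) : R :=
  match k with
  | 0 => (x == y)%:R
  | k'.+1 => \sum_z Pk mu k' x z * mu (y - z)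
  end.

(* heat kernel H_t = e^{t(P-I)} = sum_k e^{-t} t^k/k! P^k *)
Definition heat mu (t : R) (x y : {ffun 'I_n -> 'Z_q}) : R :=
  limn (series (fun k => expR (- t) * t ^+ k / (k`!)%:R * Pk mu k x y)).

Definition tv_unif (nu : {ffun 'I_n -> 'Z_q} -> R) : R :=
  2^-1 * \sum_y `|nu y - (#|{: {ffun 'I_n -> 'Z_q}}|%:R)^-1|.

Definition dist mu (t : R) : R :=
  \big[Num.max/0]_(x : {ffun 'I_n -> 'Z_q}) tv_unif (heat mu t x).

Definition tmix mu (eps : R) : R := inf [set t : R | 0 <= t /\ dist mu t <= eps].

End WalkDefs.

Section SeqDefs.
Variable R : realType.

Definition mxmaxnorm (m : nat) (M : 'M[R]_m) : R := \big[Num.max/0]_(a : 'I_m) \big[Num.max/0]_(b : 'I_m) `|M a b|.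

Definition offdiag_max (m : nat) (M : 'M[R]_m) : R :=
  \big[Num.max/0]_(a : 'I_m) \big[Num.max/0]_(b : 'I_m | a != b) `|M a b|.

(* a_k = (Psi_kk - Psi_{k,<k} (Psi_{<k,<k})^{-1} Psi_{<k,k})^{-1}, k = 0..m-1
   (0-indexed; for k = 0 the block is empty so a = Psi_00^{-1}) *)
Definition schur_a (m : nat) (Psi : 'M[R]_m) (k : 'I_m) : R :=
  let w := widen_ord (ltnW (ltn_ord k)) in
  let A : 'M[R]_k := \matrix_(i, j) Psi (w i) (w j) in
  let b : 'rV[R]_k := \row_j Psi k (w j) in
  let c : 'cV[R]_k := \col_i Psi (w i) k in
  (Psi k k - (b *m invmx A *m c) 0 0)^-1.

Definition corr_condition (Gam : forall n : nat, 'M[R]_n) (g : R -> R) : Prop :=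
  [/\ (forall n, Gam n \in unitmx),
      (exists B : R, forall n (a b : 'I_n), `|invmx (Gam n) a b| <= B),
      (forall x y : R, 1 <= x -> x <= y -> g y <= g x),
      (forall x : R, 1 <= x -> 0 <= g x) &
      g x @[x --> +oo] --> 0] /\
  (forall alpha : R, 1 <= alpha -> forall n : nat,
     \sum_(k < n) powR (alpha * n%:R) (- schur_a (invmx (Gam n)) k) <= g alpha).

Definition decay_condition (q : nat -> nat) (sigma2 : nat -> R)
    (mu : forall n : nat, {ffun 'I_n -> 'Z_(q n)} -> R) : Prop :=
  forall t : nat -> R,
    (forall n, n%:R * (q n)%:R ^+ 2 * ln n%:R / (4 * pi ^+ 2 * sigma2 n) <= t n) ->
    (fun n => \sum_(x : {ffun 'I_n -> 'Z_(q n)} |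
                    [exists i, (Num.sqrt (q n)%:R)^-1 < `|2 * pi * repR R (x i) / (q n)%:R|])
        expR (2 * t n * (charfun (mu n) (fun i => 2 * pi * repR R (x i) / (q n)%:R) - 1)))
      @ \oo --> 0.

End SeqDefs.
Arguments decay_condition {R} q sigma2 mu.

(* Main.v *)
Require Import Defs.
From HB Require Import structures.
From mathcomp Require Import all_boot all_order all_algebra.
From mathcomp Require Import all_classical all_reals all_analysis.
From mathcomp Require Import ring lra zify.
Import Order.TTheory GRing.Theory Num.Theory.
Import numFieldNormedType.Exports.
Set Implicit Arguments.
Unset Strict Implicit.
Unset Printing Implicit Defensive.
Local Open Scope ring_scope.
Local Open Scope classical_set_scope.

(* Part (a): by Fourier inversion, 4 d(t)^2 is at most the sum of exp (2 t (Phi(2 pi y / q) - 1))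
   over the nonzero frequencies y. The Decay Condition handles the far frequencies. At the near ones,
   cos u <= 1 - u^2/2 + u^4/24 bounds the summand by (alpha n)^(- y^T Gamma y). Iterated Schur
   complements write y^T Gamma y as a sum of squares a_k (y_k - m_k(y_1, .., y_(k-1)))^2, so summing
   out the coordinates one at a time bounds the Gaussian sum by a product of shifted theta series,
   each at most 1 + 3 (alpha n)^(- a_k).
   Part (b): the second moment method for the test function sum_i cos(2 pi x_i / q). *)

(** The a_k are Schur complements in Psi, while the exponent is the form of Gamma = Psi^-1.
    Elimination is therefore run on the system Psi z = y, whose solution is z = Gamma y: the form is
    y . z, and its pivots enter inverted, exactly as the a_k. The shifts m_k are arbitrary reals, so
    the theta estimate has to be uniform in the shift. It is proved for exponents at least 32, and
    a_k >= 1 / Psi_kk >= 1 / S brings every exponent log(alpha n) a_k into that range once log n >=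
    32 S. Its constant 3 fits under the 2 + S in the definition of alpha because S >= 1. The factor
    (1 - r^2 / (12 q))^-1 in t_n cancels exactly what the quartic term of the cosine costs at near
    frequencies. Symmetry of mu allows real cosines throughout; an arbitrary integer phase takes
    over the role of the complex exponential. In (b), squaring the test function produces the
    frequencies e_i + e_j and e_i - e_j. Small correlations make their eigenvalues almost twice as
    far from 1 as those of a single axis, so the variance stays of order n. *)

(** * Taylor bounds for sine and cosine *)

Section Trigonometry.
Variable R : realType.
Implicit Types x u : R.

Lemma cos_half x : cos x = 1 - 2 * sin (x / 2) ^+ 2.
Proof.
have {1}-> : x = (x / 2) *+ 2 by rewrite mulr2n; field.
by rewrite cos_mulr2n cos2sin2; ring.
Qed.

Lemma ge0_of_derive (f df : R -> R) x :
  (forall y : R, is_derive y (1 : R) f (df y)) -> (forall y, 0 <= y -> 0 <= df y) ->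
  f 0 = 0 -> 0 <= x -> 0 <= f x.
Proof.
move=> Hd Hp f0; rewrite le_eqVlt => /predU1P[<-|x0]; first by rewrite f0.
have Hc : {within `[0, x], continuous f}.
  apply: continuous_subspaceT => y.
  by apply: differentiable_continuous; apply/derivable1_diffP; have [] := Hd y.
have [c cx] := MVT x0 (fun y _ => Hd y) Hc.
rewrite f0 !subr0 => ->; apply: mulr_ge0; last exact: ltW.
by apply: Hp; move: cx; rewrite in_itv /= => /andP[/ltW].
Qed.

Lemma sin_le_id x : 0 <= x -> sin x <= x.
Proof.
move=> x0; rewrite -subr_ge0.
have Hd (y : R) : is_derive y (1 : R) (fun z => z - sin z) (1 - cos y).
  exact: is_derive_eq.
apply: (ge0_of_derive Hd) x0 => [y _|]; first by rewrite subr_ge0 cos_le1.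
by rewrite sin0 subr0.
Qed.

Lemma normr_sin_le x : `|sin x| <= `|x|.
Proof.
wlog x0 : x / 0 <= x => [H|].
  by have [/H//|/ltW x0] := lerP 0 x; rewrite -normrN -sinN -[leRHS]normrN H ?oppr_ge0.
rewrite (ger0_norm x0) ler_norml sin_le_id // andbT.
rewrite -subr_ge0 opprK.
have Hd (y : R) : is_derive y (1 : R) (fun z => sin z + z) (cos y + 1).
  exact: is_derive_eq.
apply: (ge0_of_derive Hd) x0 => [y _|]; first by rewrite -lerBlDr sub0r cos_geN1.
by rewrite sin0 addr0.
Qed.

Lemma cos_ge x : 1 - x ^+ 2 / 2 <= cos x.
Proof.
rewrite cos_half.
have : sin (x / 2) ^+ 2 <= (x / 2) ^+ 2.
  by rewrite -real_normK ?num_real // -[leRHS]real_normK ?num_real // ler_pXn2r ?nnegrE // normr_sin_le.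
lra.
Qed.

Lemma sin_ge x : 0 <= x -> x - x ^+ 3 / 6 <= sin x.
Proof.
move=> x0; rewrite -subr_ge0.
have Hd (y : R) : is_derive y (1 : R) (fun z => sin z - (z - z ^+ 3 / 6))
    (cos y - (1 - y ^+ 2 / 2)).
  by apply: is_derive_eq; rewrite /GRing.scale /=; field.
apply: (ge0_of_derive Hd) x0 => [y _|]; first by rewrite subr_ge0 cos_ge.
by rewrite sin0 expr0n /= mul0r !subr0.
Qed.

(** The half-angle formula reduces the quartic bound to squaring [sin_ge]. Squaring is monotone only
    while the cubic is nonnegative; beyond that [v ^+ 2 - v ^+ 4 / 3] is itself nonpositive. *)
Lemma cos_le x : cos x <= 1 - x ^+ 2 / 2 + x ^+ 4 / 24.
Proof.
wlog x0 : x / 0 <= x => [H|].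
  have [/H//|/ltW x0] := lerP 0 x; rewrite -cosN.
  by have := H (- x); rewrite oppr_ge0 sqrrN (_ : (- x) ^+ 4 = x ^+ 4); [apply | ring].
rewrite cos_half; set v := x / 2.
have -> : x = 2 * v by rewrite /v; field.
have v0 : 0 <= v by rewrite /v divr_ge0.
have Hs := sin_ge v0.
suff : v ^+ 2 - v ^+ 4 / 3 <= sin v ^+ 2 by nra.
have [h|h] := lerP 0 (v - v ^+ 3 / 6).
  have : (v - v ^+ 3 / 6) ^+ 2 <= sin v ^+ 2 by rewrite ler_pXn2r ?nnegrE // (le_trans h).
  apply: le_trans; rewrite -subr_ge0.
  have -> : (v - v ^+ 3 / 6) ^+ 2 - (v ^+ 2 - v ^+ 4 / 3) = (v ^+ 3 / 6) ^+ 2 by field.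
  exact: sqr_ge0.
apply: (@le_trans _ _ 0); last exact: sqr_ge0.
have -> : v ^+ 2 - v ^+ 4 / 3 = v * ((v - v ^+ 3 / 6) * 2 - v) by field.
by apply: mulr_ge0_le0 => //; lra.
Qed.

End Trigonometry.

(** * Cosine characters of Z_q and representatives modulo q *)

Section CyclicCharacters.
Variables (R : realType) (q : nat).
Hypothesis q1 : (1 < q)%N.

(** The real part of a character of Z_q, taken on integers so that identities between
    representatives reduce to divisibility by q. *)
Definition cosq (m : int) : R := cos (2 * pi * m%:~R / q%:R).

Let q0 : q%:R != 0 :> R.
Proof. by rewrite pnatr_eq0 -lt0n (ltn_trans _ q1). Qed.

Lemma cosqN m : cosq (- m) = cosq m.
Proof. by rewrite /cosq mulrNz mulrN mulNr cosN. Qed.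

Lemma cosq0 : cosq 0 = 1.
Proof. by rewrite /cosq mulr0 mul0r cos0. Qed.

Lemma cosq_add_sub m p : cosq (p + m) + cosq (p - m) = 2 * cosq m * cosq p.
Proof.
rewrite /cosq.
have -> : 2 * pi * (p + m)%:~R / q%:R = 2 * pi * p%:~R / q%:R + 2 * pi * m%:~R / q%:R :> R.
  by rewrite rmorphD /=; ring.
have -> : 2 * pi * (p - m)%:~R / q%:R = 2 * pi * p%:~R / q%:R - 2 * pi * m%:~R / q%:R :> R.
  by rewrite rmorphB /=; ring.
by rewrite cosB cosD; ring.
Qed.

Lemma cosq_cong m p : (q%:Z %| m - p)%Z -> cosq m = cosq p.
Proof.
move=> /dvdzP[k E]; have -> : m = p + k * q%:Z by rewrite -E addrC subrK.
rewrite /cosq rmorphD rmorphM /= mulrDr mulrDl.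
have -> : 2 * pi * (k%:~R * q%:~R) / q%:R = k%:~R * (pi *+ 2) :> R.
  by rewrite mulr2n -pmulrn; field.
have per (j : nat) (x : R) : cos (x + (pi *+ 2) *+ j) = cos x.
  exact: periodicn (@cosD2pi R) j x.
case: k E => j _; first by rewrite -pmulrn [_ * (pi *+ 2)]mulr_natl per.
rewrite NegzE mulrNz mulNr -[LHS](per j.+1); congr cos.
by rewrite -[_ *+ j.+1]mulr_natl pmulrn; ring.
Qed.

(** For a residue 0 < k < q the half-angle formula gives [cosq k = 1 - 2 sin(pi k / q)^2], and this
    sine is positive. *)
Lemma cosq_eq1 m : cosq m = 1 -> (q%:Z %| m)%Z.
Proof.
have qz : q%:Z != 0 by rewrite -lt0n (ltn_trans _ q1).
set k := (m %% q%:Z)%Z => H.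
have km : cosq k = 1.
  by rewrite -H; apply: cosq_cong; rewrite -eqz_mod_dvd /k modz_mod.
have k0 : 0 <= k by exact: modz_ge0.
have kq : k < q%:Z by apply: ltz_pmod; rewrite ltz_nat (ltn_trans _ q1).
apply/dvdz_mod0P; rewrite -/k; apply/eqP/negPn/negP => kn0.
have kp : 0 < k by rewrite lt_def kn0.
move: km; rewrite /cosq cos_half.
suff : 0 < sin (2 * pi * k%:~R / q%:R / 2 : R).
  by move/(exprn_gt0 2) => s0 H1; lra.
have -> : 2 * pi * k%:~R / q%:R / 2 = pi * (k%:~R / q%:R) :> R by field.
apply: sin_gt0_pi; rewrite mulr_gt0 ?pi_gt0 ?divr_gt0 ?ltr0z ?ltr0n ?(ltn_trans _ q1) //=.
rewrite gtr_pMr ?pi_gt0 // ltr_pdivrMr ?ltr0n ?(ltn_trans _ q1) // mul1r.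
by rewrite pmulrn ltr_int.
Qed.

Lemma rep_dvd (a : 'Z_q) : (q%:Z %| rep a - (a : nat)%:Z)%Z.
Proof.
rewrite /rep; case: ifP => _; first by rewrite subrr dvdz0.
by rewrite addrAC subrr add0r rpredN dvdzz.
Qed.

Lemma val_dvd (a : 'Z_q) : (q%:Z %| (a : nat)%:Z - rep a)%Z.
Proof. by rewrite -rpredN opprB rep_dvd. Qed.

Lemma repD_dvd (a b : 'Z_q) : (q%:Z %| rep (a + b) - (rep a + rep b))%Z.
Proof.
have -> : rep (a + b) - (rep a + rep b) =
  (rep (a + b) - ((a + b)%R : nat)%:Z) + ((a : nat)%:Z - rep a) + ((b : nat)%:Z - rep b)
   + (((a + b)%R : nat)%:Z - (a + b)%N%:Z) by rewrite PoszD; ring.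
have H : (q%:Z %| ((a + b)%R : nat)%:Z - (a + b)%N%:Z)%Z.
  have E : ((a + b)%R : nat) = ((a + b)%N %% q)%N.
    by rewrite /=; congr (_ %% _)%N; exact: Zp_cast.
  by rewrite -eqz_mod_dvd !modz_nat E modn_mod.
by rewrite !(rpredD (rpredD (rpredD _ _) _) H) ?rep_dvd ?val_dvd.
Qed.

Lemma rep0 : rep (0 : 'Z_q) = 0.
Proof. by rewrite /rep /= muln0 (ltn_trans _ q1). Qed.

Lemma rep_eq0_dvd (a : 'Z_q) : (q%:Z %| rep a)%Z -> a = 0.
Proof.
move=> H; have : (q%:Z %| (a : nat)%:Z)%Z by rewrite -[X in (_ %| X)%Z](subrK (rep a)) rpredD ?val_dvd.
rewrite dvdzE /= => /dvdn_leq; have aq : (a < q)%N by rewrite -[X in (_ < X)%N](Zp_cast q1).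
case: (posnP a) => [a0 _|ap /(_ isT)]; first exact/val_inj.
by rewrite leqNgt aq.
Qed.

Lemma repB_dvd (a b : 'Z_q) : (q%:Z %| rep (a - b) - (rep a - rep b))%Z.
Proof.
have := repD_dvd (a - b) b; rewrite subrK -rpredN => H.
by have -> : rep (a - b) - (rep a - rep b) = - (rep a - (rep (a - b) + rep b)) by ring.
Qed.

Lemma rep_inj : injective (@rep q).
Proof.
move=> a b E; apply/eqP; rewrite -subr_eq0; apply/eqP/rep_eq0_dvd.
by have := repB_dvd a b; rewrite E subrr subr0.
Qed.

Lemma rep1_dvd : (q%:Z %| rep (1%R : 'Z_q) - 1)%Z.
Proof.
have := rep_dvd (1%R : 'Z_q).
by rewrite /= Zp_cast // modn_small.
Qed.

End CyclicCharacters.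

Lemma cvg_sumr (R : realType) (U : Type) (F : set_system U) (FF : Filter F) (I : Type)
    (s : seq I) (P : pred I) (f : I -> U -> R) (l : I -> R) :
  (forall i, P i -> f i x @[x --> F] --> l i) ->
  \sum_(i <- s | P i) f i x @[x --> F] --> \sum_(i <- s | P i) l i.
Proof.
move=> H; elim: s => [|i s IH].
  by rewrite big_nil; under eq_fun do rewrite big_nil; exact: cvg_cst.
rewrite big_cons; under eq_fun do rewrite big_cons.
by case: ifP => // Pi; apply: cvgD => //; exact: H.
Qed.

(** * Fourier analysis of the walk and its heat kernel *)

Section WalkFourier.
Variables (R : realType) (q n : nat).
Hypothesis q1 : (1 < q)%N.
Notation G := {ffun 'I_n -> 'Z_q}.
Notation cosq := (cosq R q).
Implicit Types (z : 'I_n -> int) (x y w : G) (c : int).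

(** Frequencies are integer vectors, so that combinations such as e_i + e_j can be used without
    reduction modulo q; [freq] embeds the group among them. *)
Definition dot z x : int := \sum_i z i * rep (x i).

Definition freq w : 'I_n -> int := fun i => rep (w i).

Lemma dot_freqC w x : dot (freq w) x = dot (freq x) w.
Proof. by apply: eq_bigr => i _; rewrite mulrC. Qed.

Lemma dotD_dvd z x y : (q%:Z %| dot z (x + y) - (dot z x + dot z y))%Z.
Proof.
rewrite /dot -big_split -sumrB /= rpred_sum // => i _; rewrite ffunE -mulrDr -mulrBr.
by rewrite dvdz_mull // repD_dvd.
Qed.

Lemma dotB_dvd z x y : (q%:Z %| dot z (x - y) - (dot z x - dot z y))%Z.
Proof.
rewrite /dot -!sumrB /= rpred_sum // => i _; rewrite !ffunE -!mulrBr.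
by rewrite dvdz_mull // repB_dvd.
Qed.

Lemma cosq_dotD z x y c : cosq (dot z (x + y) + c) = cosq (dot z x + dot z y + c).
Proof.
apply: cosq_cong => //; have -> : dot z (x + y) + c - (dot z x + dot z y + c) =
  dot z (x + y) - (dot z x + dot z y) by ring.
exact: dotD_dvd.
Qed.

Lemma cosq_dotB z x y c : cosq (dot z (x - y) + c) = cosq (dot z x - dot z y + c).
Proof.
apply: cosq_cong => //; have -> : dot z (x - y) + c - (dot z x - dot z y + c) =
  dot z (x - y) - (dot z x - dot z y) by ring.
exact: dotB_dvd.
Qed.

Lemma dot0 z : dot z 0 = 0.
Proof. by apply: big1 => i _; rewrite ffunE rep0 // mulr0. Qed.

Lemma dot0l z x : (forall i, z i = 0) -> dot z x = 0.
Proof. by move=> z0; apply: big1 => i _; rewrite z0 mul0r. Qed.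

Lemma cosq_dotN z x c : cosq (dot z (- x) + c) = cosq (c - dot z x).
Proof. by rewrite -[- x]sub0r cosq_dotB dot0 sub0r addrC. Qed.

(* The sum [F c] satisfies [F (c + z i) = F c = F (c - z i)], whose average is
   [cosq (z i) * F c] with [cosq (z i) <> 1]. *)
Lemma cosq_orthogonal z i c : ~~ (q%:Z %| z i)%Z -> \sum_x cosq (dot z x + c) = 0.
Proof.
move=> zi; pose F c := \sum_x cosq (dot z x + c).
have Fs d : F d = F (d + z i).
  rewrite /F (reindex_inj (addIr [ffun j => (j == i)%:R])) /=.
  apply: eq_bigr => x _; rewrite cosq_dotD; apply: cosq_cong => //.
  rewrite [X in _ + X + d - _](_ : _ = z i * rep (1%R : 'Z_q)).
    have -> : dot z x + z i * rep (1%R : 'Z_q) + d - (dot z x + (d + z i)) =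
       z i * (rep (1%R : 'Z_q) - 1) by ring.
    by rewrite dvdz_mull // rep1_dvd.
  rewrite /dot (bigD1 i) //= big1 => [|j ji]; rewrite ffunE ?eqxx ?addr0 //.
  by rewrite (negbTE ji) rep0 // mulr0.
have E : F c + F c = 2 * cosq (z i) * F c.
  rewrite {1}(Fs c) [X in _ + X = _](_ : _ = F (c - z i)); last by rewrite [RHS]Fs subrK.
  rewrite /F -big_split mulr_sumr; apply: eq_bigr => x _.
  by rewrite -cosq_add_sub -!addrA.
have : (1 - cosq (z i)) * F c = 0 by lra.
move/eqP; rewrite mulf_eq0 => /orP[|/eqP //].
by rewrite subr_eq0 => /eqP/esym/(cosq_eq1 q1) h; rewrite h in zi.
Qed.

Variable mu : G -> R.
Hypothesis musym : forall x, mu (- x) = mu x.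

Definition eigenval z : R := \sum_x mu x * cosq (dot z x).

(** Symmetry of [mu] lets the phases [c + dot z x] and [c - dot z x] be averaged, and the product
    formula then factors out [cosq c]. Being valid for every phase, this makes each shifted cosine
    an eigenfunction. *)
Lemma eigenval_shift z c : \sum_x mu x * cosq (dot z x + c) = eigenval z * cosq c.
Proof.
have E : \sum_x mu x * cosq (dot z x + c) = \sum_x mu x * cosq (c - dot z x).
  rewrite (reindex_inj (@oppr_inj G)) /=; apply: eq_bigr => x _.
  by rewrite musym cosq_dotN.
have : \sum_x mu x * cosq (dot z x + c) + \sum_x mu x * cosq (dot z x + c) =
       2 * (eigenval z * cosq c).
  rewrite {2}E -big_split /eigenval mulr_suml mulr_sumr; apply: eq_bigr => x _.
  by rewrite /= -mulrDr [dot z x + c]addrC cosq_add_sub /=; ring.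
lra.
Qed.

Lemma charfun_eigenval z : charfun mu (fun i => 2 * pi * (z i)%:~R / q%:R) = eigenval z.
Proof.
rewrite /charfun /expect; apply: eq_bigr => x _; congr (_ * cos _).
rewrite /dot rmorph_sum mulr_sumr mulr_suml; apply: eq_bigr => i _.
by rewrite rmorphM /= /repR; ring.
Qed.

Lemma Pk_char k x z c :
  \sum_y Pk mu k x y * cosq (dot z y + c) = eigenval z ^+ k * cosq (dot z x + c).
Proof.
elim: k => [|k IH] /=.
  rewrite (bigD1 x) //= big1 => [|y /negbTE]; first by rewrite eqxx addr0 expr0.
  by rewrite eq_sym => ->; rewrite mul0r.
under eq_bigr do rewrite mulr_suml.
rewrite exchange_big /= exprSr -mulrA [eigenval z * _]mulrC mulrA -IH mulr_suml.
apply: eq_bigr => w _.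
rewrite (reindex_inj (addIr w)) /=.
under eq_bigr do rewrite addrK -mulrA cosq_dotD -addrA.
by rewrite -mulr_sumr eigenval_shift; ring.
Qed.

Notation N := (#|{: G}|%:R : R).

Lemma card_neq0 : N != 0.
Proof. by rewrite pnatr_eq0 -lt0n; apply/card_gt0P; exists 0. Qed.

Lemma Pk_fourier k x y :
  Pk mu k x y = N^-1 * \sum_w eigenval (freq w) ^+ k * cosq (dot (freq w) (y - x)).
Proof.
have N0 := card_neq0.
elim: k y => [|k IH] y /=.
  have [<-|xy] := eqVneq x y.
    rewrite subrr; under eq_bigr do rewrite dot0 cosq0 expr0 mulr1.
    by rewrite sumr_const /= mulVf.
  rewrite [X in _ * X](_ : _ = 0) ?mulr0 //.
  (* [dot] is symmetric on group elements, so the sum over frequencies is a sum over the group of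
     the nontrivial character [freq (y - x)]. *)
  under eq_bigr do rewrite expr0 mul1r dot_freqC -[dot _ _]addr0.
  have /existsP[i Hi] : [exists i, (y - x) i != 0].
    apply: contraT => /existsPn H; case/negP: xy; rewrite eq_sym -subr_eq0.
    by apply/eqP/ffunP => i; have := H i; rewrite negbK => /eqP ->; rewrite ffunE.
  by apply: (@cosq_orthogonal _ i); apply: contraNN Hi => /(rep_eq0_dvd q1) ->.
under eq_bigr do rewrite IH -mulrA mulr_suml.
rewrite -mulr_sumr exchange_big /=; congr (_ * _); apply: eq_bigr => w _.
under eq_bigr do rewrite -mulrA.
rewrite -mulr_sumr exprSr -mulrA; congr (_ * _).
rewrite (reindex_inj (inv_inj (subKr y))) /=.
rewrite -[cosq _ in RHS]cosqN -eigenval_shift; apply: eq_bigr => v _.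
rewrite subKr mulrC; congr (_ * _).
have := cosq_dotB (freq w) (y - x) v 0; rewrite !addr0 => E.
by rewrite (addrAC y) E -cosqN opprB.
Qed.

Variable t : R.

Lemma poisson_series_cvg (lam : R) :
  series (fun k => expR (- t) * t ^+ k / (k`!)%:R * lam ^+ k) @ \oo
    --> expR (t * (lam - 1)).
Proof.
have -> : expR (t * (lam - 1)) = expR (- t) * expR (t * lam) by rewrite -expRD; congr expR; ring.
rewrite (_ : series _ = fun m => expR (- t) * series (exp_coeff (t * lam)) m).
  by apply: cvgMl_tmp; exact: is_cvg_series_exp_coeff.
apply/funext => m; rewrite /series /= mulr_sumr; apply: eq_bigr => k _.
by rewrite /exp_coeff /= exprMn; ring.
Qed.

(** [heat] is a [limn], which is informative only once convergence is known. The group is finite, so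
    the series can be summed one eigenvalue at a time. *)
Lemma heat_cvg x y :
  series (fun k => expR (- t) * t ^+ k / (k`!)%:R * Pk mu k x y) @ \oo -->
   N^-1 * \sum_w expR (t * (eigenval (freq w) - 1)) * cosq (dot (freq w) (y - x)).
Proof.
rewrite (_ : series _ = fun m => N^-1 * \sum_w
  series (fun k => expR (- t) * t ^+ k / (k`!)%:R * eigenval (freq w) ^+ k) m *
    cosq (dot (freq w) (y - x))).
  apply: cvgMl_tmp; apply: cvg_sumr => w _; apply: cvgMr_tmp.
  exact: poisson_series_cvg.
apply/funext => m; rewrite /series /=.
under eq_bigr do rewrite Pk_fourier mulrCA mulr_sumr.
rewrite -mulr_sumr exchange_big /=; congr (_ * _); apply: eq_bigr => w _.
by rewrite mulr_suml; apply: eq_bigr => k _; rewrite mulrA.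
Qed.

Lemma heat_fourier x y : heat mu t x y =
  N^-1 * \sum_w expR (t * (eigenval (freq w) - 1)) * cosq (dot (freq w) (y - x)).
Proof. by apply: cvg_lim => //; exact: heat_cvg. Qed.

Lemma heat_char x z c : \sum_y heat mu t x y * cosq (dot z y + c) =
  expR (t * (eigenval z - 1)) * cosq (dot z x + c).
Proof.
have H : (fun m => \sum_y series (fun k => expR (- t) * t ^+ k / (k`!)%:R * Pk mu k x y) m
    * cosq (dot z y + c)) @ \oo --> \sum_y heat mu t x y * cosq (dot z y + c).
  apply: cvg_sumr => y _; apply: cvgMr_tmp; rewrite heat_fourier; exact: heat_cvg.
have E : (fun m => \sum_y series (fun k => expR (- t) * t ^+ k / (k`!)%:R * Pk mu k x y) m
    * cosq (dot z y + c)) = fun m =>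
  series (fun k => expR (- t) * t ^+ k / (k`!)%:R * eigenval z ^+ k) m * cosq (dot z x + c).
  apply/funext => m; rewrite /series /=.
  under eq_bigr do rewrite mulr_suml.
  rewrite exchange_big /= mulr_suml; apply: eq_bigr => k _.
  by rewrite -[RHS]mulrA -Pk_char mulr_sumr; apply: eq_bigr => y _; rewrite mulrA.
rewrite E in H; apply: (cvg_unique _ H) => //.
by apply: cvgMr_tmp; exact: poisson_series_cvg.
Qed.

Hypotheses (mu0 : forall x, 0 <= mu x) (mu1 : \sum_x mu x = 1).

Lemma eigenval_zero z : (forall i, z i = 0) -> eigenval z = 1.
Proof.
by move=> z0; rewrite -mu1; apply: eq_bigr => x _; rewrite dot0l // cosq0 mulr1.
Qed.

Lemma heat_sum1 x : \sum_y heat mu t x y = 1.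
Proof.
have := heat_char x (fun => 0) 0.
rewrite eigenval_zero // subrr mulr0 expR0 mul1r dot0l // add0r cosq0 => <-.
by apply: eq_bigr => y _; rewrite dot0l // add0r cosq0 mulr1.
Qed.

Lemma Pk_ge0 k x y : 0 <= Pk mu k x y.
Proof. by elim: k y => [|k IH] y /=; [exact: ler0n | apply: sumr_ge0 => w _; exact: mulr_ge0]. Qed.

Lemma heat_ge0 x y : 0 <= t -> 0 <= heat mu t x y.
Proof.
move=> t0; apply: limr_ge; first by apply/cvg_ex; eexists; exact: heat_cvg.
apply: nearW => m; apply: sumr_ge0 => k _.
by rewrite !mulr_ge0 ?expR_ge0 ?exprn_ge0 ?invr_ge0 ?Pk_ge0.
Qed.

(* Expanding one factor of [heat ^ 2] in characters and summing the other against
   them squares the Fourier coefficients. *)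
Lemma heat_l2 x : \sum_y (heat mu t x y - N^-1) ^+ 2 =
  N^-1 * \sum_(w : G | w != 0) expR (2 * t * (eigenval (freq w) - 1)).
Proof.
have N0 := card_neq0.
have S2 : \sum_y heat mu t x y ^+ 2 = N^-1 * \sum_w expR (2 * t * (eigenval (freq w) - 1)).
  under eq_bigr do rewrite expr2 {2}heat_fourier mulrCA mulr_sumr.
  rewrite -mulr_sumr exchange_big /=; congr (_ * _); apply: eq_bigr => w _.
  transitivity (expR (t * (eigenval (freq w) - 1)) *
    \sum_y heat mu t x y * cosq (dot (freq w) y + (- dot (freq w) x))).
    rewrite mulr_sumr; apply: eq_bigr => y _; rewrite mulrCA; congr (_ * (_ * _)).
    by have := cosq_dotB (freq w) y x 0; rewrite !addr0.
  by rewrite heat_char subrr cosq0 mulr1 -expRD; congr expR; ring.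
transitivity (\sum_y heat mu t x y ^+ 2 - 2 * N^-1 * \sum_y heat mu t x y
    + \sum_(y : G) (N^-1) ^+ 2).
  by rewrite mulr_sumr -sumrB -big_split /=; apply: eq_bigr => y _; ring.
rewrite S2 heat_sum1 sumr_const (bigD1 (0 : G)) //= eigenval_zero; last first.
  by move=> i; rewrite /freq ffunE rep0.
by rewrite subrr mulr0 expR0 -mulr_natl; field.
Qed.

End WalkFourier.

(** * Total variation distance: spectral bound and decay *)

Section Distances.
Variable R : realType.

(** The sum of [|d i| * (s - h i)^2], or of [|d i| * (s + h i)^2] where [d i] is negative, is a
    nonnegative quadratic polynomial in [s]; its minimiser is [s = B / A]. *)
Lemma weighted_cauchy (I : finType) (d h : I -> R) :
  (\sum_i d i * h i) ^+ 2 <= (\sum_i `|d i|) * \sum_i `|d i| * h i ^+ 2.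
Proof.
set A := \sum_i `|d i|; set B := \sum_i d i * h i; set C := \sum_i `|d i| * h i ^+ 2.
have A0 : 0 <= A by exact: sumr_ge0.
have K s : 0 <= A * s ^+ 2 - 2 * B * s + C.
  have -> : A * s ^+ 2 - 2 * B * s + C =
      \sum_i (`|d i| * s ^+ 2 - 2 * (d i * h i) * s + `|d i| * h i ^+ 2).
    by rewrite /A /B /C mulr_suml mulr_sumr mulr_suml -sumrB -big_split.
  apply: sumr_ge0 => i _; case: (ger0P (d i)) => hd.
    have -> : d i * s ^+ 2 - 2 * (d i * h i) * s + d i * h i ^+ 2 = d i * (s - h i) ^+ 2 by ring.
    by rewrite mulr_ge0 ?sqr_ge0.
  have -> : - d i * s ^+ 2 - 2 * (d i * h i) * s + - d i * h i ^+ 2 = - d i * (s + h i) ^+ 2 by ring.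
  by rewrite mulr_ge0 ?sqr_ge0 // oppr_ge0 ltW.
have [A00|An] := eqVneq A 0.
  have d0 i : d i = 0.
    by apply/eqP; rewrite -normr_eq0; apply/eqP; apply: (psumr_eq0P _ A00) => // j _; exact: normr_ge0.
  by rewrite A00 mul0r /B big1 ?expr0n // => i _; rewrite d0 mul0r.
have := K (B / A); have -> : A * (B / A) ^+ 2 - 2 * B * (B / A) + C = C - B ^+ 2 / A by field.
by rewrite subr_ge0 ler_pdivrMr ?lt_def ?An // mulrC.
Qed.

Variables (q n : nat).
Hypothesis q1 : (1 < q)%N.
Notation G := {ffun 'I_n -> 'Z_q}.
Variable mu : G -> R.
Hypotheses (mu0 : forall x, 0 <= mu x) (mu1 : \sum_x mu x = 1)
  (musym : forall x, mu (- x) = mu x).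

(** Cauchy-Schwarz with unit weights bounds the squared l1 norm by the group order times the squared
    l2 norm, and the order cancels the prefactor in [heat_l2]. *)
Lemma dist_le_spectral t : dist mu t <=
  2^-1 * Num.sqrt (\sum_(w : G | w != 0) expR (2 * t * (eigenval mu (freq w) - 1))).
Proof.
apply: bigmax_le => [|x _]; first by rewrite mulr_ge0 ?invr_ge0 // sqrtr_ge0.
rewrite /tv_unif ler_wpM2l ?invr_ge0 //.
set s := \sum_y _; have s0 : 0 <= s by exact: sumr_ge0.
rewrite -(ger0_norm s0) -sqrtr_sqr ler_wsqrtr //.
have := weighted_cauchy (fun=> 1) (fun y : G => `|heat mu t x y - #|{: G}|%:R^-1|).
under [X in X ^+ 2 <= _]eq_bigr do rewrite mul1r.
move/le_trans; apply; under eq_bigr do rewrite normr1.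
under [X in _ * X]eq_bigr do rewrite normr1 mul1r real_normK ?num_real //.
by rewrite (heat_l2 q1 musym t mu1) sumr_const mulrA mulfV ?card_neq0 // mul1r.
Qed.

Lemma eigenval_le1 z : eigenval mu z <= 1.
Proof.
rewrite -mu1; apply: ler_sum => x _.
by rewrite -[leRHS]mulr1 ler_wpM2l // cos_le1.
Qed.

Hypothesis mugen : supp_generates mu.

(** If the average of the cosines is 1, each equals 1 on the support. The points where q divides
    [dot (freq w) x] form a subgroup containing the support, hence everything, and the unit vectors
    then force [w = 0]. *)
Lemma eigenval_eq1 (w : G) : eigenval mu (freq w) = 1 -> w = 0.
Proof.
move=> H.
have H0 : \sum_x mu x * (1 - cosq R q (dot (freq w) x)) = 0.
  under eq_bigr do rewrite mulrBr mulr1.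
  by rewrite sumrB mu1 -[X in _ - X]/(eigenval mu (freq w)) H subrr.
pose S : {pred G} := fun x => (q%:Z %| dot (freq w) x)%Z.
have inS x : (x \in S) = (q%:Z %| dot (freq w) x)%Z by [].
have D x : x \in S.
  apply: mugen.
  - by rewrite inS dot0 // dvdz0.
  - move=> y y'; rewrite !inS => h h'.
    rewrite -(subrK (dot (freq w) y + dot (freq w) y') (dot _ _)).
    exact: (rpredD (dotD_dvd q1 _ _ _) (rpredD h h')).
  - move=> y; rewrite !inS => h.
    have := dotB_dvd q1 (freq w) 0 y; rewrite dot0 // !sub0r opprK => h'.
    by rewrite -(addrK (dot (freq w) y) (dot _ _)) rpredB.
  - move=> y my; rewrite inS; apply: (@cosq_eq1 R) => //.
    have P i : true -> 0 <= mu i * (1 - cosq R q (dot (freq w) i)).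
      by move=> _; rewrite mulr_ge0 // subr_ge0 cos_le1.
    have /eqP := psumr_eq0P P H0 (i := y) isT.
    by rewrite mulf_eq0 gt_eqF //= subr_eq0 => /eqP.
apply/ffunP => i; rewrite ffunE; apply: (rep_eq0_dvd q1).
have := D [ffun j => (j == i)%:R]; rewrite inS /dot (bigD1 i) //= big1 => [|j ji]; last first.
  by rewrite ffunE (negbTE ji) rep0 // mulr0.
rewrite ffunE eqxx addr0 /freq => h.
have -> : rep (w i) = rep (w i) * rep (1%R : 'Z_q) - rep (w i) * (rep (1%R : 'Z_q) - 1) by ring.
by rewrite rpredB // dvdz_mull // rep1_dvd.
Qed.

(** A lower bound on the infimum [tmix] requires its set to be nonempty. [M] is chosen so that the
    group order times [1 / (2 M)] is [(2 e)^2]. *)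
Lemma dist_small e : 0 < e -> exists2 t, 0 <= t & dist mu t <= e.
Proof.
move=> e0; pose M := #|{: G}|%:R / (8 * e ^+ 2) : R.
have N0 : 0 < #|{: G}|%:R :> R by rewrite lt_def card_neq0 /=.
have M0 : 0 < M by rewrite divr_gt0 // mulr_gt0 // exprn_gt0.
have gap w : 0 <= 1 - eigenval mu (freq w) by rewrite subr_ge0 eigenval_le1.
(* A sum stands in for the maximum over [w]; the term at [w = 0] is [M / 0 = 0]. *)
pose t := \sum_(w : G) M / (1 - eigenval mu (freq w)).
have tw (w : G) : M / (1 - eigenval mu (freq w)) <= t.
  rewrite /t (bigD1 w) //= lerDl sumr_ge0 // => v _.
  by rewrite divr_ge0 // ltW.
exists t; first by apply: sumr_ge0 => w _; rewrite divr_ge0 // ltW.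
apply: le_trans (dist_le_spectral t) _.
suff H : \sum_(w : G | w != 0) expR (2 * t * (eigenval mu (freq w) - 1)) <= (2 * e) ^+ 2.
  have := ler_wsqrtr H; rewrite sqrtr_sqr ger0_norm ?mulr_ge0 // ?(ltW e0) //; lra.
have -> : (2 * e) ^+ 2 = \sum_(w : G) (2 * M)^-1.
  rewrite sumr_const -mulr_natl /M.
  by field; rewrite (gt_eqF e0) (gt_eqF N0).
rewrite big_mkcond; apply: ler_sum => w _; case: ifP => w0; last first.
    by rewrite invr_ge0 mulr_ge0 // ltW.
  have g0 : 0 < 1 - eigenval mu (freq w).
    rewrite lt_def gap andbT subr_eq0 eq_sym.
    by apply/eqP => /eigenval_eq1 h; rewrite h eqxx in w0.
  have -> : 2 * t * (eigenval mu (freq w) - 1) = - (2 * t * (1 - eigenval mu (freq w))) by ring.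
  have h : 2 * M <= 2 * t * (1 - eigenval mu (freq w)).
    by rewrite -mulrA ler_wpM2l // -ler_pdivrMr.
  have M2 : 0 < 2 * M by exact: mulr_gt0.
  rewrite expRN lef_pV2 ?posrE ?expR_gt0 ?M2 //.
  by apply: le_trans h _; apply: le_trans (expR_ge1Dx _); rewrite lerDr.
Qed.

End Distances.

(** * Moments of the increment and bounds on its characteristic function *)

Section Moments.
Variables (R : realType) (q n : nat) (r sigma2 : R).
Notation G := {ffun 'I_n -> 'Z_q}.
Variable mu : G -> R.
Hypothesis walk : walk_setup r sigma2 mu.

Let q1 : (1 < q)%N. Proof. by case: walk => -[]. Qed.
Let mu0 : forall x, 0 <= mu x. Proof. by case: walk => -[? ? ? []]. Qed.
Let mu1 : \sum_x mu x = 1. Proof. by case: walk => -[? ? ? []]. Qed.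
Let musym : forall x, mu (- x) = mu x. Proof. by case: walk => -[]. Qed.

Lemma rep_bounds (a : 'Z_q) : - q%:Z <= 2 * rep a < q%:Z.
Proof.
have aq : (a < q)%N by rewrite -[X in (_ < X)%N](Zp_cast q1).
by rewrite /rep; case: ifP => h; lia.
Qed.

(** For even q the class of q/2 has representative -q/2 and is its own opposite; the strict bound
    excludes it. Otherwise [rep (- a) + rep a] is a multiple of q smaller than q in absolute
    value. *)
Lemma repN_supp (a : 'Z_q) : `|repR R a| < q%:R / 2 -> rep (- a) = - rep a.
Proof.
rewrite /repR -intr_norm ltr_pdivlMr // -[q%:R]/((q%:Z)%:~R) -[2]/((2%:Z)%:~R) -intrM ltr_int => h.
have {h} /andP[h1 h2] : - q%:Z < rep a * 2 < q%:Z by rewrite -ltr_norml normrM.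
have := repB_dvd q1 0 a; rewrite rep0 // !sub0r opprK => /dvdzP[k E].
have /andP[h3 h4] := rep_bounds (- a).
have [k0|[k0|k0]] : k = 0 \/ 1 <= k \/ k <= -1 by lia.
- by apply/eqP; rewrite -addr_eq0 E k0 mul0r.
- have : q%:Z <= k * q%:Z by rewrite ler_peMl.
  by rewrite -E => H; exfalso; lra.
- have : k * q%:Z <= - q%:Z by rewrite -mulN1r ler_wpM2r.
  by rewrite -E => H; exfalso; lra.
Qed.

Lemma meanY_eq0 i : meanY mu i = 0.
Proof.
have : meanY mu i = - meanY mu i.
  rewrite /meanY /expect {1}(reindex_inj (@oppr_inj G)) /= -sumrN; apply: eq_bigr => x _.
  rewrite musym ffunE; have := mu0 x; rewrite le_eqVlt => /predU1P[<-|mx].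
    by rewrite !mul0r oppr0.
  by rewrite /repR repN_supp ?mulrNz ?mulrN //; case: walk => _ [_ _ /(_ _ mx)].
lra.
Qed.

Definition quad (Gam : 'M[R]_n) (y : 'I_n -> R) : R := \sum_i \sum_j y i * y j * Gam i j.

Lemma covY_corrY i j : covY mu i j = sigma2 / n%:R * corrY mu i j.
Proof.
have [_ [_ _ _ V]] := walk; have [[_ _ s0 _ _] _] := walk.
have n0 : 0 < n%:R :> R by rewrite ltr0n (leq_ltn_trans _ (ltn_ord i)).
have v0 : 0 < sigma2 / n%:R by rewrite divr_gt0.
by rewrite mxE !V -expr2 sqrtr_sqr gtr0_norm // mulrCA mulfV ?mulr1 // gt_eqF.
Qed.

Lemma second_moment (theta : 'I_n -> R) :
  \sum_x mu x * (\sum_i theta i * repR R (x i)) ^+ 2 = sigma2 / n%:R * quad (corrY mu) theta.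
Proof.
rewrite /quad mulr_sumr.
under [RHS]eq_bigr do rewrite mulr_sumr.
under [RHS]eq_bigr => i _ do under eq_bigr => j _ do rewrite mulrCA -covY_corrY /covY /expect mulr_sumr.
under [LHS]eq_bigr do rewrite expr2 mulr_suml mulr_sumr.
rewrite exchange_big /=; apply: eq_bigr => i _.
rewrite [RHS]exchange_big /=; apply: eq_bigr => x _.
rewrite !mulr_sumr; apply: eq_bigr => j _.
by rewrite !meanY_eq0 !subr0; ring.
Qed.

Lemma charfun_ge theta : 1 - 2^-1 * (sigma2 / n%:R * quad (corrY mu) theta) <= charfun mu theta.
Proof.
rewrite -second_moment -[X in X - _ <= _]mu1 mulr_sumr -sumrB; apply: ler_sum => x _ /=.
set u := \sum_i _; have -> : mu x - 2^-1 * (mu x * u ^+ 2) = mu x * (1 - u ^+ 2 / 2) by ring.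
by rewrite ler_wpM2l // cos_ge.
Qed.

(** On the support [u ^+ 4 <= rho ^+ 2 * u ^+ 2], so the quartic term of [cos_le] is a fraction
    [rho ^+ 2 / 12] of the quadratic one. *)
Lemma charfun_le theta (rho : R) :
  (forall x, 0 < mu x -> `|\sum_i theta i * repR R (x i)| <= rho) ->
  charfun mu theta <= 1 - 2^-1 * (1 - rho ^+ 2 / 12) * (sigma2 / n%:R * quad (corrY mu) theta).
Proof.
move=> H; rewrite -second_moment -[X in _ <= X - _]mu1 mulr_sumr -sumrB; apply: ler_sum => x _ /=.
set u := \sum_i _.
have -> : mu x - 2^-1 * (1 - rho ^+ 2 / 12) * (mu x * u ^+ 2) =
  mu x * (1 - u ^+ 2 / 2 + rho ^+ 2 * u ^+ 2 / 24) by field.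
have := mu0 x; rewrite le_eqVlt => /predU1P[<-|mx]; first by rewrite !mul0r.
rewrite ler_wpM2l //; apply: le_trans (cos_le _) _.
rewrite lerD2l ler_wpM2r ?invr_ge0 // -[X in u ^+ X]/(2 + 2)%N exprD.
rewrite ler_wpM2r ?sqr_ge0 // -[leLHS]real_normK ?num_real //.
by rewrite ler_pXn2r ?nnegrE ?H // (le_trans _ (H x mx)).
Qed.

End Moments.

(** * Theta series with an arbitrary real shift *)

Section ThetaBound.
Variable R : realType.
Implicit Types L m u : R.

(** With [a = expR (u / 2)] and [b = expR (- (u / 2))] the excess over 2 is [(a - b)^2], and
    [a - b = a * (1 - expR (- u)) <= a * u]. *)
Lemma two_cosh_le u : 0 <= u -> expR u + expR (- u) <= 2 + u ^+ 2 * expR u.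
Proof.
move=> u0; pose a := expR (u / 2); pose b := expR (- (u / 2)).
have ab : a * b = 1 by rewrite /a /b -expRD subrr expR0.
have -> : expR u = a ^+ 2 by rewrite /a -expRM_natl; congr expR; field.
have -> : expR (- u) = b ^+ 2 by rewrite /b -expRM_natl; congr expR; field.
have a0 : 0 < a by exact: expR_gt0.
have b0 : 0 < b by exact: expR_gt0.
have ba : b <= a by rewrite ler_expR; lra.
have h : a - b <= a * u.
  have : a * (1 - u) <= b.
    have -> : b = a * expR (- u) by rewrite /a -expRD; congr expR; field.
    by rewrite ler_wpM2l ?(ltW a0) // expR_ge1Dx.
  lra.
have : (a - b) ^+ 2 <= (a * u) ^+ 2.
  by rewrite ler_pXn2r ?nnegrE ?subr_ge0 // mulr_ge0 // ltW.
by rewrite exprMn sqrrB ab; lra.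
Qed.

(* For [1 / 4 <= m] each term is small. For smaller [m], with [p = expR (- L)], the central
   term loses a factor [1 + L m^2], which outweighs the gain [2 p (cosh (2 m L) - 1)] of the
   other two; [32] makes all of this hold. *)
Lemma theta_three_terms L m : 32 <= L -> 0 <= m <= 1 / 2 ->
  expR (- (L * m ^+ 2)) + expR (- (L * (1 - m) ^+ 2)) + expR (- (L * (1 + m) ^+ 2))
    <= 1 + 2 * expR (- L).
Proof.
move=> L32 /andP[m0 m2].
have L0 : 0 < L by lra.
have half x : 1 <= x -> expR (- x) <= 1 / 2.
  move=> x1; rewrite expRN div1r lef_pV2 ?posrE ?expR_gt0 //.
  by apply: le_trans (expR_ge1Dx _); lra.
have [m4|m4] := lerP (1 / 4) m.
  have h1 : expR (- (L * m ^+ 2)) <= 1 / 2 by apply: half; nra.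
  have h2 : expR (- (L * (1 - m) ^+ 2)) <= 1 / 2 by apply: half; nra.
  have h3 : expR (- (L * (1 + m) ^+ 2)) <= expR (- L) by rewrite ler_expR; nra.
  have := expR_gt0 (- L); lra.
pose E := expR (- (L * m ^+ 2)); pose p := expR (- L); pose u := 2 * m * L.
have u0 : 0 <= u by rewrite /u !mulr_ge0 // ltW.
have -> : expR (- (L * (1 - m) ^+ 2)) = E * (p * expR u).
  by rewrite /E /p /u -!expRD; congr expR; ring.
have -> : expR (- (L * (1 + m) ^+ 2)) = E * (p * expR (- u)).
  by rewrite /E /p /u -!expRD; congr expR; ring.
have p0 : 0 < p by exact: expR_gt0.
have E0 : 0 < E by exact: expR_gt0.
have H1 : p * expR u <= expR (- (L / 2)).
  by rewrite /p -expRD ler_expR /u; nra.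
(* The second-order bound on the exponential gives at least [L ^+ 2 / 8], which is at least [4 * L]
   precisely when [L >= 32]. *)
have H2 : 4 * L * expR (- (L / 2)) <= 1.
  rewrite expRN ler_pdivrMr ?expR_gt0 // mul1r.
  have L2 : 0 <= L / 2 by lra.
  have := expR_ge1Dxn 1 L2; rewrite (_ : 2`! = 2)%N //; apply: le_trans; nra.
have H3 : p * (expR u + expR (- u)) <= 2 * p + L * m ^+ 2.
  apply: (@le_trans _ _ (p * (2 + u ^+ 2 * expR u))).
    by rewrite ler_wpM2l ?two_cosh_le // ltW.
  have -> : p * (2 + u ^+ 2 * expR u) = 2 * p + u ^+ 2 * (p * expR u) by ring.
  rewrite lerD2l; apply: (@le_trans _ _ (u ^+ 2 * expR (- (L / 2)))).
    by rewrite ler_wpM2l ?sqr_ge0.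
  have -> : u ^+ 2 * expR (- (L / 2)) = L * m ^+ 2 * (4 * L * expR (- (L / 2))).
    by rewrite /u; ring.
  by rewrite ler_piMr // mulr_ge0 ?sqr_ge0 // ltW.
have H4 : E * (1 + L * m ^+ 2) <= 1.
  rewrite /E expRN mulrC ler_pdivrMr ?expR_gt0 // mul1r.
  exact: expR_ge1Dx.
have E1 : E <= 1.
  by rewrite /E expR_le1 oppr_le0 mulr_ge0 ?sqr_ge0 // ltW.
have : E * (p * (expR u + expR (- u))) <= E * (2 * p + L * m ^+ 2).
  by rewrite ler_wpM2l // ltW.
have : E * p <= p by rewrite ler_piMl // ltW.
rewrite -/E -/p; move: (expR u) (expR (- u)) (L * m ^+ 2) H4 => c d s; nra.
Qed.

Lemma sum_inj_nat_le (I : finType) (P : pred I) (u : I -> nat) (g : nat -> R) (K : nat) :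
  (forall i j, P i -> P j -> u i = u j -> i = j) -> (forall i, P i -> (u i < K)%N) ->
  (forall k, 0 <= g k) -> \sum_(i | P i) g (u i) <= \sum_(k < K) g k.
Proof.
move=> inj uK g0; case: K uK => [|K] uK.
  rewrite big_ord0 big1 // => i Pi; by have := uK _ Pi.
rewrite (partition_big (fun i => inord (u i) : 'I_K.+1) predT) //=.
apply: ler_sum => k _.
have [i /andP[Pi ik]|none] := pickP (fun i => P i && (inord (u i) == k)); last first.
  by rewrite big_pred0.
have uik : u i = k by move/eqP: ik => <-; rewrite inordK // uK.
rewrite (big_pred1 i) ?uik // => j /=.
apply/andP/eqP => [[Pj /eqP jk]|->]; last by rewrite Pi.
by apply: inj => //; rewrite uik -jk inordK // uK.
Qed.

(** For positive [p], [p^2 / (1 - p) <= p / 2] amounts to [p <= 1 / 3]. *)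
Lemma geometric_sum_le (p : R) K : 0 <= p <= 1 / 3 -> \sum_(k < K) p ^+ k.+2 <= p / 2.
Proof.
move=> /andP[p0 p3].
have H : (\sum_(k < K) p ^+ k.+2) * (1 - p) = p ^+ 2 - p ^+ K.+2.
  elim: K => [|K IH]; first by rewrite big_ord0 mul0r subrr.
  by rewrite big_ord_recr /= mulrDl IH !exprS; ring.
have := exprn_ge0 K.+2 p0; nra.
Qed.

(** The values 0, 1 and -1 contribute at most [1 + 2 p] with [p = expR (- L)]. For |k| >= 2 one has
    [(k - m)^2 >= |k|], so each of the two tails is geometric and at most [p / 2]; hence the 3. *)
Lemma theta_bound_centered (I : finType) (v : I -> int) L m : injective v ->
  32 <= L -> 0 <= m <= 1 / 2 ->
  \sum_i expR (- (L * ((v i)%:~R - m) ^+ 2)) <= 1 + 3 * expR (- L).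
Proof.
move=> vi L32 m2; pose F (k : int) := expR (- (L * (k%:~R - m) ^+ 2)).
pose p := expR (- L).
have p0 : 0 < p by exact: expR_gt0.
have p3 : p <= 1 / 3.
  rewrite /p expRN div1r lef_pV2 ?posrE ?expR_gt0 //.
  by apply: le_trans (expR_ge1Dx _); lra.
have F0 k : 0 <= F k by exact: expR_ge0.
rewrite -/(F _) (bigID (fun i => 0 <= v i)) /=.
pose K := \max_i `|v i|%N.
have vK i : (`|v i| <= K)%N by exact: (leq_bigmax (F := fun i => `|v i|%N)).
have A : \sum_(i | 0 <= v i) F (v i) <= F 0 + F 1 + p / 2.
  have -> : \sum_(i | 0 <= v i) F (v i) = \sum_(i | 0 <= v i) F (`|v i|%N)%:Z.
    by apply: eq_bigr => i v0; rewrite gez0_abs.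
  apply: le_trans (sum_inj_nat_le (g := fun k => F k%:Z) (K := K.+2) _ _ _) _ => //.
  - by move=> i j i0 j0 ij; apply: vi; rewrite -(gez0_abs i0) -(gez0_abs j0) ij.
  - by move=> i _; rewrite ltnS (leq_trans (vK i)).
  rewrite !big_ord_recl /= addrA lerD2l; apply: le_trans (geometric_sum_le K _); last first.
    by rewrite p3 ltW.
  apply: ler_sum => k _; rewrite /p -expRM_natl ler_expR mulrN lerN2.
  rewrite /F /bump /= !add1n mulrC ler_wpM2l //; first by lra.
  have : 2 <= k.+2%:R :> R by rewrite ler_nat.
  rewrite -pmulrn; move: m2 => /andP[]; nra.
have B : \sum_(i | ~~ (0 <= v i)) F (v i) <= F (-1) + p / 2.
  have -> : \sum_(i | ~~ (0 <= v i)) F (v i) = \sum_(i | ~~ (0 <= v i)) F (- (`|v i|.-1.+1)%:Z).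
    apply: eq_bigr => i; rewrite -ltNge => v0; congr F.
    by lia.
  apply: le_trans (sum_inj_nat_le (u := fun i => `|v i|.-1) (g := fun k => F (- (k.+1)%:Z)) (K := K.+1) _ _ _) _ => //.
  - by move=> i j; rewrite -!ltNge => i0 j0 ij; apply: vi; lia.
  - by move=> i _; rewrite ltnS (leq_trans (leq_pred _)).
  rewrite !big_ord_recl /= lerD2l; apply: le_trans (geometric_sum_le K _); last first.
    by rewrite p3 ltW.
  apply: ler_sum => k _; rewrite /p -expRM_natl ler_expR mulrN lerN2.
  rewrite /F /bump /= !add1n mulrC ler_wpM2l //; first by lra.
  have : 2 <= k.+2%:R :> R by rewrite ler_nat.
  rewrite mulrNz -pmulrn; move: m2 => /andP[]; nra.
have := theta_three_terms L32 m2.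
move: A B; rewrite /F /= mulr0z mulr1z mulrNz mulr1z sub0r sqrrN.
have -> : (-1 - m) ^+ 2 = (1 + m) ^+ 2 by ring.
rewrite -/p; lra.
Qed.

(** Translating by the integer nearest to [m], and reflecting if the remainder is negative,
    preserves injectivity and brings the shift into [0, 1/2]. *)
Lemma theta_bound (I : finType) (v : I -> int) L m : injective v -> 32 <= L ->
  \sum_i expR (- (L * ((v i)%:~R - m) ^+ 2)) <= 1 + 3 * expR (- L).
Proof.
move=> vi L32; pose k := Num.floor (m + 1 / 2).
have k1 : k%:~R <= m + 1 / 2 by exact: floor_le.
have : m + 1 / 2 < (k + 1)%:~R by exact: floorD1_gt.
rewrite rmorphD /= => k2.
have [h|h] := lerP 0 (m - k%:~R).
  have vi' : injective (fun i => v i - k) by move=> i j /addIr/vi.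
  apply: le_trans (theta_bound_centered (m := m - k%:~R) vi' L32 _); last by lra.
  by apply: ler_sum => i _; rewrite rmorphB /= opprB addrA subrK.
have vi' : injective (fun i => k - v i) by move=> i j /addrI/oppr_inj/vi.
apply: le_trans (theta_bound_centered (m := k%:~R - m) vi' L32 _); last by lra.
apply: ler_sum => i _; rewrite rmorphB /= le_eqVlt; apply/orP; left; apply/eqP.
by congr (expR (- (_ * _))); ring.
Qed.

End ThetaBound.

(** * Gaussian sums in triangular coordinates *)

Section GaussianSum.
Variables (R : realType) (T : finType) (v : T -> int).
Hypothesis vinj : injective v.

(** Extension by 0 to indices in [nat], so that one family of shifts [m] serves all dimensions of
    the induction. *)
Definition natext k (y : {ffun 'I_k -> T}) : nat -> R :=
  fun i => if insub i is Some j then (v (y j))%:~R else 0.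

Arguments natext : simpl never.

Definition ffun_rcons k (p : {ffun 'I_k -> T} * T) : {ffun 'I_k.+1 -> T} :=
  [ffun i => if unlift ord_max i is Some j then p.1 j else p.2].

Lemma ffun_rcons_bij k : bijective (@ffun_rcons k).
Proof.
exists (fun y : {ffun 'I_k.+1 -> T} => ([ffun j : 'I_k => y (lift ord_max j)], y ord_max)).
  move=> [y t]; congr (_, _); last by rewrite ffunE unlift_none.
  by apply/ffunP => j; rewrite !ffunE liftK.
move=> y; apply/ffunP => i; rewrite ffunE.
by case: unliftP => [j ->|->] //=; rewrite ffunE.
Qed.

Lemma natext_rcons_lt k p i : (i < k)%N -> natext (@ffun_rcons k p) i = natext p.1 i.
Proof.
move=> ik; rewrite /natext (insubT (fun i => i < k.+1)%N (leq_trans ik (leqnSn k))) insubT /=.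
rewrite ffunE; set o := Sub _ _.
have -> : o = lift ord_max (Ordinal ik).
  by apply: val_inj; rewrite /= /bump leqNgt ik.
by rewrite liftK.
Qed.

Lemma natext_rcons_last k p : natext (@ffun_rcons k p) k = (v p.2)%:~R.
Proof.
rewrite /natext (insubT (fun i => i < k.+1)%N (ltnSn k)) /= ffunE.
have -> : Sub k (ltnSn k) = ord_max :> 'I_k.+1 by exact: val_inj.
by rewrite unlift_none.
Qed.

(* Summing over the last coordinate first, each factor is a shifted theta series. *)
Lemma gaussian_sum_le (m : nat -> (nat -> R) -> R) (L : nat -> R) k :
  (forall l y y', (forall i, (i < l)%N -> y i = y' i) -> m l y = m l y') ->
  (forall l, (l < k)%N -> 32 <= L l) ->
  \sum_(y : {ffun 'I_k -> T}) expR (- \sum_(l < k) L l * (natext y l - m l (natext y)) ^+ 2)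
    <= \prod_(l < k) (1 + 3 * expR (- L l)).
Proof.
move=> mloc; elim: k => [|k IH] HL.
  rewrite big_ord0; under eq_bigr do rewrite big_ord0 oppr0 expR0.
  by rewrite sumr_const card_ffun card_ord expn0.
rewrite (reindex (@ffun_rcons k)) /=; last by apply: onW_bij; exact: ffun_rcons_bij.
have E (y : {ffun 'I_k -> T}) t : \sum_(l < k.+1) L l * (natext (ffun_rcons (y, t)) l - m l (natext (ffun_rcons (y, t)))) ^+ 2 =
    \sum_(l < k) L l * (natext y l - m l (natext y)) ^+ 2
    + L k * ((v t)%:~R - m k (natext y)) ^+ 2.
  rewrite big_ord_recr /= natext_rcons_last; congr (_ + _ * (_ - _) ^+ 2).
    apply: eq_bigr => l _; rewrite natext_rcons_lt //; congr (_ * (_ - _) ^+ 2).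
    by apply: mloc => i il; rewrite natext_rcons_lt // (ltn_trans il).
  by apply: mloc => i il; rewrite natext_rcons_lt.
rewrite (eq_bigr (fun p => expR (- \sum_(l < k) L l * (natext p.1 l - m l (natext p.1)) ^+ 2) *
   expR (- (L k * ((v p.2)%:~R - m k (natext p.1)) ^+ 2)))); last first.
  by move=> [y t] _; rewrite E opprD expRD.
rewrite -(pair_bigA _ (fun y t => expR (- \sum_(l < k) L l * (natext y l - m l (natext y)) ^+ 2) *
   expR (- (L k * ((v t)%:~R - m k (natext y)) ^+ 2)))) /= big_ord_recr /=.
apply: (@le_trans _ _ (\sum_(y : {ffun 'I_k -> T})
   expR (- \sum_(l < k) L l * (natext y l - m l (natext y)) ^+ 2) * (1 + 3 * expR (- L k)))).
  apply: ler_sum => y _; rewrite -mulr_sumr ler_wpM2l ?expR_ge0 //.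
  exact: theta_bound vinj (HL k (ltnSn k)).
rewrite -mulr_suml ler_wpM2r ?addr_ge0 ?mulr_ge0 ?expR_ge0 //.
by apply: IH => l lk; apply: HL; rewrite ltnS ltnW.
Qed.

End GaussianSum.

(** * Iterated Schur complements of a positive definite form *)

Section Schur.
Variables (R : realType) (f : nat -> nat -> R) (N : nat).
Hypothesis fsym : forall i j, f i j = f j i.
Hypothesis fpos : forall k y, (k <= N)%N -> (exists2 i, (i < k)%N & y i != 0) ->
  0 < \sum_(i < k) \sum_(j < k) y i * y j * f i j.

(** Entries indexed by [nat] let the leading blocks of all sizes share one [f] without casts between
    ordinals. *)
Definition leading k : 'M[R]_k := \matrix_(i, j) f i j.

(* Coefficients of the regression of the [l]-th coordinate on the previous ones. *)
Definition regr l : nat -> R := fun i =>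
  if insub i is Some j then ((\row_(j < l) f l j) *m invmx (leading l)) 0 j else 0.

Definition schur_compl l : R :=
  f l l - ((\row_(j < l) f l j) *m invmx (leading l) *m (\col_(i < l) f i l)) 0 0.

(** A nonzero row in the kernel would give the form the value 0. *)
Lemma leading_unit k : (k <= N)%N -> leading k \in unitmx.
Proof.
move=> kN; rewrite -row_free_unit; apply/inj_row_free => u uA.
apply/eqP; apply: contraT => u0.
pose y i := if insub i is Some j then u 0 j else 0.
have yE (i : 'I_k) : y i = u 0 i by rewrite /y valK.
have /fpos : exists2 i, (i < k)%N & y i != 0.
  have [i ui] : exists i, u 0 i != 0.
    apply/existsP; apply: contraT => /existsPn H; case/negP: u0.
    by apply/eqP/rowP => i; rewrite mxE; apply/eqP; have := H i; rewrite negbK.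
  by exists i; rewrite ?yE.
move=> /(_ kN); rewrite exchange_big /= big1 ?ltxx // => j _.
under eq_bigr do rewrite !yE mulrAC.
rewrite -mulr_suml; have /rowP/(_ j) := uA; rewrite !mxE.
by under eq_bigr do rewrite mxE; move=> ->; rewrite mul0r.
Qed.

Lemma regrE l (j : 'I_l) : regr l j = ((\row_(j < l) f l j) *m invmx (leading l)) 0 j.
Proof. by rewrite /regr valK. Qed.

Lemma regr_solve l j : (l <= N)%N -> (j < l)%N -> \sum_(i < l) regr l i * f i j = f l j.
Proof.
move=> lN jl; have /rowP/(_ (Ordinal jl)) := mulmxKV (leading_unit lN) (\row_(j < l) f l j).
rewrite [LHS]mxE [RHS]mxE /= => <-; apply: eq_bigr => i _.
by rewrite regrE [leading _ _ _]mxE.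
Qed.

Lemma schur_complE l : schur_compl l = f l l - \sum_(i < l) regr l i * f i l.
Proof.
rewrite /schur_compl mxE; congr (_ - _); apply: eq_bigr => i _.
by rewrite regrE [(\col_i _) _ _]mxE.
Qed.

(** The complement is the value of the form at the vector (- [regr l], 1), hence positive; the
    amount subtracted from [f l l] is its value at [regr l], hence nonnegative. *)
Lemma schur_compl_bounds l : (l < N)%N -> 0 < schur_compl l <= f l l.
Proof.
move=> lN; have lN' := ltnW lN; rewrite schur_complE.
have S1 : \sum_(i < l) \sum_(j < l) regr l i * regr l j * f i j = \sum_(i < l) regr l i * f i l.
  rewrite exchange_big /=; apply: eq_bigr => j _.
  rewrite fsym -(regr_solve lN' (ltn_ord j)) mulr_sumr.
  by apply: eq_bigr => i _; ring.
apply/andP; split; last first.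
  rewrite lerBlDr lerDl -S1.
  have [none|ri] := pselect (forall i : 'I_l, regr l i = 0).
    by rewrite big1 // => i _; rewrite big1 // => j _; rewrite none !mul0r.
  by apply/ltW/fpos => //; move/existsNP: ri => [i /eqP ri]; exists i.
pose y i := if i == l then 1 else - regr l i.
have yl : y l = 1 by rewrite /y eqxx.
have yE (i : 'I_l) : y i = - regr l i by rewrite /y ltn_eqF.
have /(fpos lN) : exists2 i, (i < l.+1)%N & y i != 0 by exists l; rewrite ?yl ?oner_eq0.
suff -> : \sum_(i < l.+1) \sum_(j < l.+1) y i * y j * f i j = f l l - \sum_(i < l) regr l i * f i l by [].
rewrite big_ord_recr /= [X in _ + X]big_ord_recr /= yl !mul1r.
have -> : \sum_(i < l) \sum_(j < l.+1) y i * y j * f i j = 0.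
  under eq_bigr => i _.
    rewrite big_ord_recr /= yl mulr1 yE.
    under eq_bigr do rewrite yE mulrNN.
  over.
  rewrite big_split /= S1 -big_split /= big1 // => i _; ring.
rewrite add0r addrC -sumrN; congr (_ + _); apply: eq_bigr => i _.
by rewrite yE mul1r fsym mulNr.
Qed.

(* Eliminating the last unknown [z k] of the linear system [f z = y] peels off one square. *)
Lemma schur_squares k (y z : nat -> R) : (k <= N)%N ->
  (forall i, (i < k)%N -> \sum_(j < k) f i j * z j = y i) ->
  \sum_(i < k) y i * z i =
  \sum_(l < k) (schur_compl l)^-1 * (y l - \sum_(i < l) regr l i * y i) ^+ 2.
Proof.
elim: k z => [|k IH] z kN H; first by rewrite !big_ord0.
have kN' := ltnW kN.
have /andP[s0 _] := schur_compl_bounds kN.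
have W : y k - \sum_(i < k) regr k i * y i = schur_compl k * z k.
  rewrite -(H k) // big_ord_recr /=.
  under [X in _ - X]eq_bigr => i _ do
    rewrite -(H i (ltnW (ltn_ord i))) big_ord_recr /= mulrDr mulr_sumr.
  rewrite big_split /= exchange_big /=.
  have -> : \sum_(j < k) \sum_(i < k) regr k i * (f i j * z j) = \sum_(j < k) f k j * z j.
    apply: eq_bigr => j _; rewrite -(regr_solve kN' (ltn_ord j)) mulr_suml.
    by apply: eq_bigr => i _; rewrite mulrA.
  rewrite schur_complE mulrBl mulr_suml.
  by under [X in _ = _ - X]eq_bigr do rewrite -mulrA; ring.
(* By [regr_solve], spreading [z k] over the earlier unknowns with weights [regr k] reproduces its
   column, so the modified vector solves the leading system of size [k]. *)
have IH' : \sum_(i < k) y i * (z i + regr k i * z k) =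
    \sum_(l < k) (schur_compl l)^-1 * (y l - \sum_(i < l) regr l i * y i) ^+ 2.
  apply: (IH (fun i => z i + regr k i * z k)) => // i ik.
  rewrite -(H i (ltnW ik)) big_ord_recr /=.
  under eq_bigr do rewrite mulrDr; rewrite big_split /=; congr (_ + _).
  rewrite fsym -(regr_solve kN' ik) mulr_suml; apply: eq_bigr => j _.
  by rewrite fsym; ring.
rewrite big_ord_recr [RHS]big_ord_recr /= -IH' W.
have -> : \sum_(i < k) y i * (z i + regr k i * z k) =
    \sum_(i < k) y i * z i + (\sum_(i < k) regr k i * y i) * z k.
  by rewrite mulr_suml -big_split; apply: eq_bigr => i _ /=; ring.
have -> : \sum_(i < k) regr k i * y i = y k - schur_compl k * z k by rewrite -W; ring.
by field; rewrite gt_eqF.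
Qed.

End Schur.

(** * The form of Gamma through the Schur complements of its inverse *)

Section QuadraticForm.
Variables (R : realType) (n : nat) (Gam : 'M[R]_n.+1).
Hypothesis Gsym : Gam^T = Gam.
Hypothesis Gunit : Gam \in unitmx.
Hypothesis Gpos : forall y : 'I_n.+1 -> R, (exists i, y i != 0) -> 0 < quad Gam y.

Let Psi := invmx Gam.
Let f i j := Psi (inord i) (inord j).

Let fE (i j : 'I_n.+1) : f i j = Psi i j.
Proof. by rewrite /f !inord_val. Qed.

Let Psym : Psi^T = Psi.
Proof. by rewrite /Psi trmx_inv Gsym. Qed.

Let fsym i j : f i j = f j i.
Proof. by rewrite /f -{1}Psym mxE. Qed.

(** With [w] the padding of [y] by zeros, the form of [Psi] at [w] is the form of [Gam] at
    [w *m Psi], which is nonzero since [Psi] is invertible. *)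
Let fpos k y : (k <= n.+1)%N -> (exists2 i, (i < k)%N & y i != 0) ->
  0 < \sum_(i < k) \sum_(j < k) y i * y j * f i j.
Proof.
move=> kn [i ik yi]; pose y' i := if (i < k)%N then y i else 0.
pose w : 'rV[R]_n.+1 := \row_i y' i; pose v := w *m Psi.
have vG : v *m Gam = w by rewrite /v mulmxKV.
have -> : \sum_(i < k) \sum_(j < k) y i * y j * f i j = quad Gam (v 0).
  transitivity ((w *m Psi *m w^T) 0 0).
    rewrite mxE; under [RHS]eq_bigr do rewrite mxE mulr_suml.
    rewrite [RHS]exchange_big /= [LHS](big_ord_widen _ (fun i => \sum_(j < k) y i * y j * f i j) kn).
    rewrite big_mkcond; apply: eq_bigr => a _; case: ifP => ak; last first.
      by rewrite big1 // => b _; rewrite !mxE /y' ak !mul0r.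
    rewrite [LHS](big_ord_widen _ (fun j => y a * y j * f a j) kn) big_mkcond.
    apply: eq_bigr => b _; rewrite !mxE /y' ak fE; case: ifP => _; last by rewrite mulr0.
    by ring.
  have -> : w *m Psi *m w^T = v *m Gam *m v^T.
    by rewrite vG /v trmx_mul Psym mulmxA.
  rewrite mxE /quad exchange_big /=; apply: eq_bigr => b _.
  by rewrite !mxE mulr_suml; apply: eq_bigr => a _; ring.
apply: Gpos; apply/existsP; apply: contraT => /existsPn v0.
have w0 : w = 0.
  rewrite -vG; have -> : v = 0; last by rewrite mul0mx.
  by apply/rowP => j; rewrite [RHS]mxE; apply/eqP; have := v0 j; rewrite negbK.
have /rowP/(_ (Ordinal (leq_trans ik kn))) := w0.
by rewrite !mxE /y' /= ik => /eqP; rewrite (negbTE yi).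
Qed.

Lemma schur_aE (k : 'I_n.+1) : schur_a Psi k = (schur_compl f k)^-1.
Proof.
have wE (i : 'I_k) : widen_ord (ltnW (ltn_ord k)) i = inord i.
  by apply: val_inj; rewrite /= inordK // (ltn_trans (ltn_ord i)).
rewrite /schur_a /schur_compl -fE; congr (_ - _)^-1.
have -> : (\matrix_(i, j) Psi (widen_ord (ltnW (ltn_ord k)) i)
    (widen_ord (ltnW (ltn_ord k)) j)) = leading f k.
  by apply/matrixP => i j; rewrite !mxE !wE.
congr ((_ *m _ *m _) 0 0).
  by apply/rowP => i; rewrite !mxE wE /f inord_val.
by apply/colP => i; rewrite !mxE wE /f inord_val.
Qed.

(** Together with a bound on the entries of [Psi] this keeps every a_k away from 0, uniformly in the
    dimension. *)
Lemma schur_a_ge (k : 'I_n.+1) : 0 < Psi k k /\ (Psi k k)^-1 <= schur_a Psi k.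
Proof.
have /andP[s0 sf] := schur_compl_bounds fsym fpos (ltn_ord k).
rewrite schur_aE -fE; have f0 := lt_le_trans s0 sf.
by split => //; rewrite lef_pV2 ?posrE.
Qed.

Lemma quad_gaussian_sum_le (T : finType) (v : T -> int) (l : R) : injective v ->
  (forall k : 'I_n.+1, 32 <= l * schur_a Psi k) ->
  \sum_(y : {ffun 'I_n.+1 -> T}) expR (- (l * quad Gam (fun i => (v (y i))%:~R)))
   <= \prod_k (1 + 3 * expR (- (l * schur_a Psi k))).
Proof.
move=> vinj H.
pose m k (y : nat -> R) := \sum_(i < k) regr f k i * y i.
have mloc k y y' : (forall i, (i < k)%N -> y i = y' i) -> m k y = m k y'.
  by move=> yy; apply: eq_bigr => i _; rewrite yy.
have HL k : (k < n.+1)%N -> 32 <= l * (schur_compl f k)^-1.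
  by move=> kn; have := H (Ordinal kn); rewrite schur_aE.
under [leRHS]eq_bigr do rewrite schur_aE.
apply: le_trans (gaussian_sum_le vinj mloc HL).
apply: ler_sum => y _; rewrite le_eqVlt; apply/orP; left; apply/eqP; congr (expR (- _)).
have yE (i : 'I_n.+1) : natext R v y i = (v (y i))%:~R by rewrite /natext valK.
under [RHS]eq_bigr do rewrite -mulrA; rewrite -mulr_sumr; congr (_ * _).
pose u : 'cV[R]_n.+1 := \col_i natext R v y i.
(* [z = Gam u] solves [Psi z = u], so the form of [Gam] at [u] is the left-hand side of
   [schur_squares]. *)
pose z i := (Gam *m u) (inord i) 0.
have zE (i : 'I_n.+1) : z i = (Gam *m u) i 0 by rewrite /z inord_val.
rewrite /m -(schur_squares (z := z) fsym fpos) //.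
  rewrite /quad; apply: eq_bigr => i _; rewrite zE mxE mulr_sumr.
  by apply: eq_bigr => j _; rewrite mxE !yE; ring.
move=> i ni; have := mulKmx Gunit u => /colP/(_ (Ordinal ni)).
rewrite [LHS]mxE [RHS]mxE /= => <-; apply: eq_bigr => j _.
by rewrite zE /f inord_val; congr (Psi _ _ * _); apply: val_inj; rewrite /= inordK.
Qed.

End QuadraticForm.

(** * Second moment lower bound for the mixing time *)

Section LowerBound.
Variables (R : realType) (q n : nat) (r sigma2 : R).
Notation G := {ffun 'I_n -> 'Z_q}.
Variable mu : G -> R.
Hypothesis walk : walk_setup r sigma2 mu.

Let q1 : (1 < q)%N. Proof. by case: walk => -[]. Qed.
Let q0 : 0 < q%:R :> R. Proof. by rewrite ltr0n (ltn_trans _ q1). Qed.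
Let s0 : 0 < sigma2. Proof. by case: walk => -[]. Qed.
Let mu0 : forall x, 0 <= mu x. Proof. by case: walk => -[? ? ? []]. Qed.
Let mu1 : \sum_x mu x = 1. Proof. by case: walk => -[? ? ? []]. Qed.
Let musym : forall x, mu (- x) = mu x. Proof. by case: walk => -[]. Qed.
Let Gam := corrY mu.
(** [gap] is the quadratic approximation of 1 minus the eigenvalue at a coordinate axis; [kap] is
    the loss [rho ^+ 2 / 12] of [charfun_le] at [rho = 2 pi r / q]. *)
Let gap := 2 * pi ^+ 2 * sigma2 / (n%:R * q%:R ^+ 2) : R.
Let kap := pi ^+ 2 / 3 * (r ^+ 2 / q%:R ^+ 2) : R.

Let e (i k : 'I_n) : int := (k == i)%:Z.

Let dot_e i (y : G) : dot (e i) y = rep (y i).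
Proof.
rewrite /dot (bigD1 i) //= big1 => [|j ji]; last by rewrite /e (negbTE ji) mul0r.
by rewrite /e eqxx mul1r addr0.
Qed.

Let dot_add i j (y : G) : dot (fun k => e i k + e j k) y = rep (y i) + rep (y j).
Proof. by rewrite -!dot_e /dot -big_split; apply: eq_bigr => k _; rewrite mulrDl. Qed.

Let dot_sub i j (y : G) : dot (fun k => e i k - e j k) y = rep (y i) - rep (y j).
Proof. by rewrite -!dot_e /dot -sumrB; apply: eq_bigr => k _; rewrite mulrBl. Qed.

Lemma corrY_diag i : Gam i i = 1.
Proof.
have n0 : 0 < n%:R :> R by rewrite ltr0n (leq_ltn_trans _ (ltn_ord i)).
have [_ [_ _ _ V]] := walk; have := V i; rewrite /Gam mxE /varY => ->.
by rewrite -expr2 sqrtr_sqr gtr0_norm ?divr_gt0 // mulfV // gt_eqF // divr_gt0.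
Qed.

Lemma corrY_sym i j : Gam i j = Gam j i.
Proof.
rewrite !mxE [varY mu j * _]mulrC; congr (_ / _).
by rewrite /covY /expect; apply: eq_bigr => x _; congr (_ * _); rewrite mulrC.
Qed.

Lemma quad_two_axes (s u : R) i j :
  quad Gam (fun k => (k == i)%:R * s + (k == j)%:R * u) = s ^+ 2 * Gam i i + 2 * s * u * Gam i j + u ^+ 2 * Gam j j.
Proof.
have pick (F : 'I_n -> R) l : \sum_k (k == l)%:R * F k = F l.
  by rewrite (bigD1 l) //= eqxx mul1r big1 ?addr0 // => k /negbTE ->; rewrite mul0r.
have lin k : \sum_l ((k == i)%:R * s + (k == j)%:R * u) * ((l == i)%:R * s + (l == j)%:R * u) * Gam k l
    = (k == i)%:R * (s * (s * Gam k i + u * Gam k j)) + (k == j)%:R * (u * (s * Gam k i + u * Gam k j)).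
  transitivity (\sum_l ((l == i)%:R * ((k == i)%:R * (s * s * Gam k l) + (k == j)%:R * (u * s * Gam k l)) +
     (l == j)%:R * ((k == i)%:R * (s * u * Gam k l) + (k == j)%:R * (u * u * Gam k l)))).
    by apply: eq_bigr => l _; ring.
  by rewrite big_split /= !pick; ring.
rewrite /quad; under eq_bigr do rewrite lin.
by rewrite big_split /= !pick [Gam j i]corrY_sym; ring.
Qed.

Lemma eigenval_axis i : 1 - gap <= eigenval mu (e i).
Proof.
rewrite -charfun_eigenval; apply: le_trans (charfun_ge walk _).
have n0 : n%:R != 0 :> R by rewrite pnatr_eq0 -lt0n (leq_ltn_trans _ (ltn_ord i)).
have -> : quad (corrY mu) (fun k => 2 * pi * (e i k)%:~R / q%:R) = (2 * pi / q%:R) ^+ 2.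
  rewrite (_ : (fun k => _) = fun k => (k == i)%:R * (2 * pi / q%:R) + (k == i)%:R * 0); last first.
    by apply/funext => k; rewrite /e -pmulrn; ring.
  by rewrite quad_two_axes corrY_diag; ring.
rewrite /gap le_eqVlt; apply/orP; left; apply/eqP; field.
by rewrite n0 gt_eqF.
Qed.

(** The form at e_i + e_j or e_i - e_j is 2 (1 + Gam_ij) or 2 (1 - Gam_ij), so this frequency decays
    almost as if the two coordinates were independent. [kap <= 1] keeps the factor [1 - kap]
    nonnegative. *)
Lemma eigenval_two_axes i j (b : bool) (o : R) : i != j -> `|Gam i j| <= o -> kap <= 1 ->
  eigenval mu (fun k => e i k + (-1) ^+ b * e j k) <= 1 - 2 * gap * (1 - (o + kap)).
Proof.
move=> ij Go k1; rewrite -charfun_eigenval.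
have n0 : 0 < n%:R :> R by rewrite ltr0n (leq_ltn_trans _ (ltn_ord i)).
have kap0 : 0 <= kap by rewrite /kap mulr_ge0 // divr_ge0 ?sqr_ge0.
pose s := 2 * pi / q%:R : R; pose u := (-1) ^+ b * s.
have s_gt0 : 0 < s by rewrite /s divr_gt0 // mulr_gt0 // pi_gt0.
have thetaE : (fun k => 2 * pi * (e i k + (-1) ^+ b * e j k)%:~R / q%:R) =
    fun k => (k == i)%:R * s + (k == j)%:R * u.
  by apply/funext => k; rewrite /e rmorphD rmorphM /= rmorphXn /= rmorphN1 -!pmulrn /u /s; ring.
rewrite thetaE; apply: le_trans (charfun_le walk (rho := s * r) _) _.
  move=> x mx; under eq_bigr do rewrite mulrDl.
  rewrite big_split /=.
  have pick (F : 'I_n -> R) l : \sum_k (k == l)%:R * F k = F l.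
    by rewrite (bigD1 l) //= eqxx mul1r big1 ?addr0 // => k /negbTE ->; rewrite mul0r.
  under eq_bigr do rewrite -mulrA; under [X in _ + X]eq_bigr do rewrite -mulrA.
  rewrite !pick; apply: le_trans (ler_normD _ _) _.
  have us : `|u| = s by rewrite /u normrM normrX normrN1 expr1n mul1r gtr0_norm.
  rewrite (normrM s) (normrM u) us (gtr0_norm s_gt0) -mulrDr.
  rewrite ler_wpM2l ?(ltW s_gt0) //; have [_ [_ H _ _]] := walk.
  apply: le_trans (H x mx); rewrite (bigD1 i) //= (bigD1 j) 1?eq_sym //=.
  by rewrite addrA lerDl sumr_ge0.
rewrite quad_two_axes !corrY_diag.
have -> : (s * r) ^+ 2 / 12 = kap by rewrite /s /kap; field; rewrite gt_eqF.
have u2 : u ^+ 2 = s ^+ 2 by rewrite /u exprMn sqrr_sign mul1r.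
have gapE : gap = 2^-1 * (sigma2 / n%:R) * s ^+ 2.
  by rewrite /gap /s; field; rewrite !gt_eqF.
have gap0 : 0 <= gap by rewrite gapE mulr_ge0 ?sqr_ge0 // mulr_ge0 ?invr_ge0 // divr_ge0 // ltW.
have -> : s ^+ 2 * 1 + 2 * s * u * Gam i j + u ^+ 2 * 1 = 2 * s ^+ 2 * (1 + (-1) ^+ b * Gam i j).
  by rewrite u2 /u; ring.
rewrite lerD2l lerN2.
have -> : 2^-1 * (1 - kap) * (sigma2 / n%:R * (2 * s ^+ 2 * (1 + (-1) ^+ b * Gam i j))) =
  2 * gap * ((1 - kap) * (1 + (-1) ^+ b * Gam i j)) by rewrite gapE; ring.
rewrite ler_wpM2l ?(mulr_ge0 _ gap0) //.
have h : - o <= (-1) ^+ b * Gam i j.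
  by apply: lerNnormlW; rewrite normrM normrX normrN1 expr1n mul1r.
have o0 : 0 <= o by apply: le_trans Go.
have : 0 <= (1 - kap) * ((-1) ^+ b * Gam i j + o).
  by rewrite mulr_ge0 ?subr_ge0 // -lerBlDr sub0r.
have : 0 <= o * kap by rewrite mulr_ge0.
have -> : (1 - kap) * (1 + (-1) ^+ b * Gam i j) =
  (1 - kap) * ((-1) ^+ b * Gam i j + o) + o * kap + (1 - (o + kap)) by ring.
by move=> ? ?; rewrite lerDr addr_ge0.
Qed.

Variables (t o : R).
Hypotheses (t0 : 0 <= t) (kap1 : kap <= 1).
Hypothesis offdiag : forall i j, i != j -> `|Gam i j| <= o.

(** [dist] is a maximum over starting points, so one start suffices for a lower bound; from 0 every
    cosine in [F] begins at its maximum 1. *)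
Let nu (y : G) := heat mu t 0 y.
Let U : R := #|{: G}|%:R^-1.
Let F (y : G) : R := \sum_i cosq R q (rep (y i)).
Let Delta : R := \sum_y nu y * F y.

Let U0 : 0 <= U. Proof. by rewrite invr_ge0. Qed.

Let sumU : \sum_(y : G) U = 1.
Proof. by rewrite sumr_const -mulr_natl mulfV // card_neq0. Qed.

Let FF (y : G) : F y ^+ 2 = \sum_i \sum_j 2^-1 *
  (cosq R q (dot (fun k => e i k + (-1) ^+ false * e j k) y + 0) +
   cosq R q (dot (fun k => e i k + (-1) ^+ true * e j k) y + 0)).
Proof.
rewrite expr2 mulr_suml; apply: eq_bigr => i _; rewrite mulr_sumr; apply: eq_bigr => j _.
rewrite !addr0; under [X in cosq R q (dot X y) + _]eq_fun do rewrite expr0 mul1r.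
under [X in _ + cosq R q (dot X y)]eq_fun do rewrite expr1 mulN1r.
by rewrite dot_add dot_sub cosq_add_sub; field.
Qed.

(** Diagonal pairs contribute at most 1 each, the others at most [M]. It serves both [nu] and the
    uniform law, for which [M = 0]. *)
Let F_sq_le (p : G -> R) (M : R) : (forall y, 0 <= p y) -> \sum_y p y = 1 -> 0 <= M ->
  (forall i j (b : bool), i != j ->
    \sum_y p y * cosq R q (dot (fun k => e i k + (-1) ^+ b * e j k) y + 0) <= M) ->
  \sum_y p y * F y ^+ 2 <= n%:R + n%:R ^+ 2 * M.
Proof.
move=> p0 p1 M0 H.
under eq_bigr do rewrite FF mulr_sumr.
rewrite exchange_big /=.
apply: (@le_trans _ _ (\sum_(i < n) (1 + n%:R * M))); last first.
  by rewrite sumr_const card_ord -mulr_natl; rewrite le_eqVlt; apply/orP; left; apply/eqP; ring.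
apply: ler_sum => i _; under eq_bigr do rewrite mulr_sumr.
rewrite exchange_big /= (bigD1 i) //=; apply: lerD.
  rewrite -[leRHS]p1; apply: ler_sum => y _; rewrite -[leRHS]mulr1 ler_wpM2l //.
  suff c2 a b : 2^-1 * (cosq R q a + cosq R q b) <= 1 by exact: c2.
  have := cos_le1 (2 * pi * a%:~R / q%:R : R).
  have := cos_le1 (2 * pi * b%:~R / q%:R : R).
  by rewrite /cosq; lra.
apply: (@le_trans _ _ (\sum_(j < n) M)); last by rewrite sumr_const card_ord mulr_natl.
rewrite big_mkcond; apply: ler_sum => j _; case: ifP => // ji.
have ij : i != j by rewrite eq_sym ji.
have h1 := H i j false ij; have h2 := H i j true ij.
under eq_bigr do rewrite mulrCA mulrDr.
by rewrite -mulr_sumr big_split /=; lra.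
Qed.

(** Cauchy-Schwarz with weights [|nu - U|] is applied to [F] centred at [Delta / 2], midway between
    its means [Delta] under [nu] and 0 under [U]. This centring minimises the second moment under
    [nu + U], which dominates the weights. *)
Lemma second_moment_method :
  Delta ^+ 2 <= dist mu t *
   (4 * n%:R + 2 * (n%:R ^+ 2 * expR (- (2 * t * gap * (1 - (o + kap))))) - Delta ^+ 2).
Proof.
have nu0 y : 0 <= nu y by exact: heat_ge0.
have nu1 : \sum_y nu y = 1 by exact: heat_sum1.
have UF : \sum_y U * F y = 0.
  rewrite -mulr_sumr exchange_big big1 ?mulr0 //= => i _.
  under eq_bigr do rewrite -dot_e -[dot _ _]addr0.
  apply: (@cosq_orthogonal _ _ _ q1 _ i); rewrite /e eqxx.
  by rewrite dvdz1; case: (q) q1 => [|[]].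
have nuF2 : \sum_y nu y * F y ^+ 2 <= n%:R +
    n%:R ^+ 2 * expR (- (2 * t * gap * (1 - (o + kap)))).
  apply: F_sq_le => //.
  move=> i j b ij; rewrite heat_char // dot0 // addr0 cosq0 mulr1 ler_expR.
  have h := eigenval_two_axes b ij (offdiag ij) kap1.
  have -> : - (2 * t * gap * (1 - (o + kap))) = t * (1 - 2 * gap * (1 - (o + kap)) - 1) by ring.
  by rewrite ler_wpM2l // lerD2r.
have UF2 : \sum_y U * F y ^+ 2 <= n%:R + n%:R ^+ 2 * 0.
  apply: F_sq_le => // i j b ij; rewrite -mulr_sumr.
  rewrite (@cosq_orthogonal _ _ _ q1 _ i) ?mulr0 //.
  rewrite /e eqxx (negbTE ij) mulr0 addr0.
  by rewrite dvdz1; case: (q) q1 => [|[]].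
rewrite mulr0 addr0 in UF2.
pose h y := F y - Delta / 2.
have D1 : \sum_y (nu y - U) * h y = Delta.
  transitivity (Delta - \sum_y U * F y - Delta / 2 * (\sum_y nu y - \sum_(y : G) U)).
    rewrite /Delta -!sumrB mulr_sumr -sumrB; apply: eq_bigr => y _; rewrite /h /Delta; ring.
  by rewrite UF nu1 sumU; ring.
have D2 : \sum_y (nu y + U) * h y ^+ 2 =
    \sum_y nu y * F y ^+ 2 + \sum_y U * F y ^+ 2 - Delta ^+ 2 / 2.
  transitivity (\sum_y nu y * F y ^+ 2 + \sum_y U * F y ^+ 2 - Delta * (\sum_y nu y * F y)
     - Delta * (\sum_y U * F y) + Delta ^+ 2 / 4 * (\sum_y nu y + \sum_(y : G) U)).
    rewrite -big_split !mulr_sumr -big_split /= -!sumrB mulr_sumr -big_split /=.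
    by apply: eq_bigr => y _; rewrite /h; field.
  by rewrite UF nu1 sumU -/Delta; field.
have tvd : 2^-1 * \sum_y `|nu y - U| <= dist mu t.
  exact: (le_bigmax _ (fun x => tv_unif (heat mu t x)) 0).
have d0 : 0 <= \sum_y `|nu y - U| by exact: sumr_ge0.
have := weighted_cauchy (fun y => nu y - U) h; rewrite D1 => /le_trans; apply.
have W0 : 0 <= \sum_y `|nu y - U| * h y ^+ 2.
  by apply: sumr_ge0 => y _; rewrite mulr_ge0 ?sqr_ge0.
have W : \sum_y `|nu y - U| * h y ^+ 2 <= \sum_y (nu y + U) * h y ^+ 2.
  apply: ler_sum => y _; rewrite ler_wpM2r ?sqr_ge0 //.
  by apply: le_trans (ler_normB _ _) _; rewrite !ger0_norm.
apply: (@le_trans _ _ (2 * dist mu t * \sum_y (nu y + U) * h y ^+ 2)).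
  by apply: ler_pM => //; lra.
rewrite D2 -mulrA mulrCA ler_wpM2l //; last lra.
by apply: le_trans tvd; rewrite mulr_ge0 ?invr_ge0.
Qed.

Lemma Delta_ge : n%:R * expR (- (t * gap)) <= Delta.
Proof.
rewrite /Delta /F; under [leRHS]eq_bigr do rewrite mulr_sumr.
rewrite exchange_big /= mulr_natl -[n in _ *+ n]card_ord -sumr_const.
apply: ler_sum => i _.
under [leRHS]eq_bigr do rewrite -dot_e -[dot _ _]addr0.
rewrite heat_char // dot0 // addr0 cosq0 mulr1 ler_expR.
have := eigenval_axis i; have -> : - (t * gap) = t * (- gap) by ring.
by move=> h; rewrite ler_wpM2l //; lra.
Qed.

Variable eps : R.
Hypothesis eps01 : 0 < eps < 1.
Let c := (eps^-1 - 1) / 5.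

(** If [t] were smaller, then [n < c * Delta ^+ 2], that is [5 * eps * n < (1 - eps) * Delta ^+ 2],
    whereas the second moment bound carries only [4 * n]. The slack between 5 and 4 pays for the
    correction [K], hence the tolerance [(1 - eps) / 10]. *)
Lemma dist_le_lower_bound : (0 < n)%N -> 0 <= o ->
  (o + kap) * (ln n%:R + ln c) <= ln (1 + (1 - eps) / 10) ->
  dist mu t <= eps ->
  n%:R * q%:R ^+ 2 / (4 * pi ^+ 2 * sigma2) * (ln n%:R + ln c) <= t.
Proof.
move=> n0 o0 small dle; have /andP[e0 e1] := eps01.
have nR : 0 < n%:R :> R by rewrite ltr0n.
have pi0 := pi_gt0 R.
have c0 : 0 < c by rewrite /c divr_gt0 // subr_gt0 invf_gt1.
have gap0 : 0 < gap.
  rewrite /gap divr_gt0 //; first by rewrite mulr_gt0 // mulr_gt0 // exprn_gt0.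
  by rewrite mulr_gt0 // exprn_gt0.
have -> : n%:R * q%:R ^+ 2 / (4 * pi ^+ 2 * sigma2) * (ln n%:R + ln c) =
    (ln n%:R + ln c) / (2 * gap).
  by rewrite /gap; move: (@pi R) pi0 => p p0; field; rewrite !gt_eqF.
have gap2 : 0 < 2 * gap by rewrite pmulr_rgt0.
rewrite ler_pdivrMr // leNgt; apply/negP => lt_t.
have kap0 : 0 <= kap by rewrite /kap mulr_ge0 // divr_ge0 ?sqr_ge0.
pose K := expR (2 * t * gap * (o + kap)).
have K1 : K <= 1 + (1 - eps) / 10.
  have p0 : 0 < 1 + (1 - eps) / 10 by lra.
  rewrite -[leRHS]lnK ?posrE // ler_expR; apply: le_trans small.
  have -> : 2 * t * gap * (o + kap) = (o + kap) * (t * (2 * gap)) by ring.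
  by rewrite ler_wpM2l ?addr_ge0 // ltW.
pose D2 := n%:R ^+ 2 * expR (- (2 * t * gap)).
have HD : D2 <= Delta ^+ 2.
  have -> : D2 = (n%:R * expR (- (t * gap))) ^+ 2.
    by rewrite exprMn -expRM_natl /D2; congr (_ * expR _); ring.
  have h0 : 0 <= n%:R * expR (- (t * gap)) by rewrite mulr_ge0 ?expR_ge0.
  by rewrite ler_pXn2r ?nnegrE ?Delta_ge // (le_trans h0 Delta_ge).
have HDpos : n%:R < D2 * c.
  have -> : D2 * c = n%:R * (n%:R * c * expR (- (2 * t * gap))) by rewrite /D2; ring.
  rewrite -[ltLHS]mulr1 ltr_pM2l // expRN ltr_pdivlMr ?expR_gt0 // mul1r.
  have nc : 0 < n%:R * c by rewrite mulr_gt0.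
  rewrite -[ltRHS]lnK ?posrE // ltr_expR lnM ?posrE //.
  by apply: le_lt_trans lt_t; rewrite le_eqVlt; apply/orP; left; apply/eqP; ring.
have main := second_moment_method.
have E : n%:R ^+ 2 * expR (- (2 * t * gap * (1 - (o + kap)))) = D2 * K.
  by rewrite /D2 /K -[RHS]mulrA -expRD; congr (_ * expR _); ring.
rewrite E in main.
have K0 : 1 <= K.
  rewrite /K -[leLHS]expR0 ler_expR mulr_ge0 ?addr_ge0 //.
  by rewrite mulr_ge0 ?(ltW gap0) // mulr_ge0.
have D20 : 0 <= D2 by rewrite mulr_ge0 ?expR_ge0 // sqr_ge0.
set X := Delta ^+ 2 in main HD *.
have main2 : X <= eps * (4 * n%:R + (1 + (1 - eps) / 5) * X).
  have d0 : 0 <= dist mu t by exact: bigmax_ge_id.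
  have h1 : 2 * (D2 * K) - X <= (1 + (1 - eps) / 5) * X.
    have : D2 * K <= X * (1 + (1 - eps) / 10) by apply: ler_pM => //; lra.
    lra.
  apply: le_trans main _; apply: (@le_trans _ _ (dist mu t * (4 * n%:R + (1 + (1 - eps) / 5) * X))).
    by rewrite ler_wpM2l // -addrA lerD2l.
  have X0 : 0 <= X by exact: sqr_ge0.
  have a0 : 0 <= 1 + (1 - eps) / 5 by lra.
  apply: ler_wpM2r dle; apply: addr_ge0; first exact: mulr_ge0.
  exact: mulr_ge0 a0 X0.
have HX : 5 * eps * n%:R < X * (1 - eps).
  have cE : 5 * eps * c = 1 - eps by rewrite /c; field; rewrite gt_eqF.
  rewrite -cE; have : D2 * c <= X * c by rewrite ler_wpM2r // ltW.
  nra.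
have X0 : 0 <= X by exact: sqr_ge0.
(* Eliminating [m] from the last two inequalities leaves [Z * (1 - d) ^+ 2 < 0]. *)
have fin (Z m d : R) : 0 <= Z * (1 - d) ^+ 2 ->
    Z <= d * (4 * m + (1 + (1 - d) / 5) * Z) -> 5 * d * m < Z * (1 - d) -> False by lra.
exact: fin (mulr_ge0 X0 (sqr_ge0 _)) main2 HX.
Qed.

End LowerBound.

(** * Upper bound: near and far frequencies *)

Definition far (R : realType) (q n : nat) (w : {ffun 'I_n -> 'Z_q}) : bool :=
  [exists i, (Num.sqrt q%:R)^-1 < `|2 * pi * repR R (w i) / q%:R|].

Section UpperBound.
Variables (R : realType) (q n : nat) (r sigma2 : R).
Notation G := {ffun 'I_n.+1 -> 'Z_q}.
Variable mu : G -> R.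
Hypothesis walk : walk_setup r sigma2 mu.
Let Gam := corrY mu.
Hypothesis Gunit : Gam \in unitmx.

Let q1 : (1 < q)%N. Proof. by case: walk => -[]. Qed.
Let q0 : 0 < q%:R :> R. Proof. by rewrite ltr0n (ltn_trans _ q1). Qed.
Let s0 : 0 < sigma2. Proof. by case: walk => -[]. Qed.
Let mu0 : forall x, 0 <= mu x. Proof. by case: walk => -[? ? ? []]. Qed.
Let mu1 : \sum_x mu x = 1. Proof. by case: walk => -[? ? ? []]. Qed.
Let musym : forall x, mu (- x) = mu x. Proof. by case: walk => -[]. Qed.
Let v0 : 0 < sigma2 / n.+1%:R. Proof. by rewrite divr_gt0. Qed.

(* If [quad Gam y = 0] then [y . Y = 0] almost surely, whence [Gam y = 0]. *)
Lemma quad_corrY_gt0 (y : 'I_n.+1 -> R) : (exists i, y i != 0) -> 0 < quad Gam y.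
Proof.
move=> [i0 yi0]; have sm := second_moment walk y.
have T0 x : 0 <= mu x * (\sum_i y i * repR R (x i)) ^+ 2 by rewrite mulr_ge0 ?sqr_ge0.
have ge0 : 0 <= quad Gam y.
  by rewrite -(pmulr_rge0 _ v0) -sm sumr_ge0.
rewrite lt_def ge0 andbT; apply/eqP => q00.
have Z : \sum_x mu x * (\sum_i y i * repR R (x i)) ^+ 2 = 0 by rewrite sm q00 mulr0.
have as0 x : mu x * (\sum_i y i * repR R (x i)) = 0.
  have /eqP := psumr_eq0P (fun x _ => T0 x) Z (i := x) isT.
  by rewrite mulf_eq0 sqrf_eq0 => /orP[/eqP ->|/eqP ->]; rewrite ?mul0r ?mulr0.
have Gy : Gam *m (\col_i y i) = 0.
  apply/colP => i; rewrite [RHS]mxE mxE; apply: (mulfI (lt0r_neq0 v0)); rewrite mulr0 mulr_sumr.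
  under eq_bigr do rewrite mulrA -(covY_corrY walk) /covY /expect mxE mulr_suml.
  rewrite exchange_big big1 //= => x _.
  transitivity (repR R (x i) * (mu x * \sum_i y i * repR R (x i))); last by rewrite as0 mulr0.
  rewrite !mulr_sumr; apply: eq_bigr => j _; rewrite !(meanY_eq0 walk) !subr0; ring.
have /colP/(_ i0) : \col_i y i = 0 by rewrite -(mulKmx Gunit (\col_i y i)) Gy mulmx0.
by rewrite !mxE => /eqP; rewrite (negbTE yi0).
Qed.

Let Psi := invmx Gam.

(** Near frequencies have all angles at most [1 / sqrt q], so the l1 bound on the increment allows
    [rho = r / sqrt q] in [charfun_le]. *)
Lemma charfun_near_le (w : G) : ~~ far R w ->
  charfun mu (fun i => 2 * pi * repR R (w i) / q%:R) - 1 <=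
   - (2 * pi ^+ 2 * sigma2 / (n.+1%:R * q%:R ^+ 2) * (1 - r ^+ 2 / (12 * q%:R))
      * quad Gam (fun i => repR R (w i))).
Proof.
move=> /existsPn H; pose theta i := 2 * pi * repR R (w i) / q%:R : R.
have sq0 : 0 <= (Num.sqrt q%:R)^-1 :> R by rewrite invr_ge0 sqrtr_ge0.
have := charfun_le walk (theta := theta) (rho := (Num.sqrt q%:R)^-1 * r).
have -> : quad (corrY mu) theta = (2 * pi / q%:R) ^+ 2 * quad Gam (fun i => repR R (w i)).
  rewrite /quad mulr_sumr; apply: eq_bigr => i _; rewrite mulr_sumr; apply: eq_bigr => j _.
  by rewrite /theta /Gam; ring.
rewrite exprMn exprVn sqr_sqrtr ?(ltW q0) // => /(_ _)/le_trans le1.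
rewrite lerBlDl; apply: le1.
  move=> x mx; apply: le_trans (ler_norm_sum _ _ _) _.
  have [_ [_ Hr _ _]] := walk; apply: le_trans (ler_wpM2l sq0 (Hr x mx)).
  rewrite mulr_sumr; apply: ler_sum => i _; rewrite normrM ler_wpM2r //.
  by have := H i; rewrite -leNgt.
rewrite le_eqVlt; apply/orP; left; apply/eqP; move: (@pi R) (quad _ _) => p Q.
by field; rewrite !gt_eqF.
Qed.

Variable l : R.
Hypothesis l0 : 0 <= l.
Hypothesis l_large : forall k : 'I_n.+1, 32 <= l * schur_a Psi k.
Hypothesis r_small : r ^+ 2 / (12 * q%:R) < 1.

Let t := n.+1%:R * q%:R ^+ 2 * l / (4 * pi ^+ 2 * sigma2) * (1 - r ^+ 2 / (12 * q%:R))^-1.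

(** The last factor of [t] cancels the loss in [charfun_near_le], leaving [expR (- (l * quad))]. The
    near sum is enlarged to all nonzero frequencies; the missing zero frequency, of weight 1,
    accounts for the [- 1]. *)
Lemma dist_le_far_gaussian : dist mu t <= 2^-1 * Num.sqrt (
   \sum_(w : G | far R w) expR (2 * t * (charfun mu (fun i => 2 * pi * repR R (w i) / q%:R) - 1))
   + (\prod_k (1 + 3 * expR (- (l * schur_a Psi k))) - 1)).
Proof.
apply: le_trans (dist_le_spectral q1 mu1 musym t) _.
rewrite ler_wpM2l // ler_wsqrtr //.
under [leLHS]eq_bigr do rewrite -charfun_eigenval.
rewrite (bigID (far R (q:=q) (n:=n.+1))) /=; apply: lerD.
  rewrite big_mkcond [leRHS]big_mkcond; apply: ler_sum => w _.
  by case: (far R w); rewrite ?andbF // andbT; case: ifP => // _; exact: expR_ge0.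
have pi0 := pi_gt0 R.
have x0 : 0 < 1 - r ^+ 2 / (12 * q%:R) by rewrite subr_gt0.
have t0 : 0 <= 2 * t.
  apply: mulr_ge0 => //; apply: mulr_ge0; last by rewrite invr_ge0 ltW.
  apply: divr_ge0; first by apply: mulr_ge0 => //; apply: mulr_ge0 => //; exact: sqr_ge0.
  by apply: mulr_ge0; [apply: mulr_ge0 => //; exact: sqr_ge0 | exact: ltW].
have gs := quad_gaussian_sum_le (v := @rep q) _ Gunit quad_corrY_gt0 (rep_inj q1) l_large.
rewrite lerBrDr; apply: le_trans (gs _); last first.
  by apply/matrixP => i j; rewrite mxE; exact: (corrY_sym mu j i).
rewrite [leRHS](bigD1 (0 : G)) //= [leLHS]addrC; apply: lerD.
  rewrite /quad big1 ?mulr0 ?oppr0 ?expR0 // => i _; rewrite big1 // => j _.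
  by rewrite ffunE rep0 // !mul0r.
rewrite big_mkcondr; apply: ler_sum => w _; case: ifP => [nf|_]; last exact: expR_ge0.
rewrite ler_expR; apply: le_trans (ler_wpM2l t0 (charfun_near_le nf)) _.
rewrite le_eqVlt; apply/orP; left; apply/eqP; rewrite /t -/Gam.
move: (quad _ _) (r ^+ 2 / _) x0 => Q x x0.
by move: (@pi R) pi0 => p p0; field; rewrite !gt_eqF.
Qed.

End UpperBound.

(** * Passing to the infimum that defines alpha *)

Section Alpha.
Variables (R : realType) (n : nat) (a : 'I_n -> R).

(** Right continuity made quantitative: replacing [alpha] by [alpha * expR x] multiplies each term
    by [expR (- a k * x) >= 1 - A * x]. *)
Lemma powR_sum_right_continuous (alpha c0 : R) : (0 < n)%N -> 0 < alpha ->
  (forall z, alpha < z -> \sum_k powR (z * n%:R) (- a k) <= c0) ->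
  \sum_k powR (alpha * n%:R) (- a k) <= c0.
Proof.
move=> n0 al0 H; have nR : 0 < n%:R :> R by rewrite ltr0n.
set f := \sum_k _; pose A := \sum_k `|a k|.
have A0 : 0 <= A by exact: sumr_ge0.
have f0 : 0 <= f by apply: sumr_ge0 => k _; exact: powR_ge0.
have K x : 0 < x -> f * (1 - A * x) <= c0.
  move=> x0; have zx : alpha < alpha * expR x by rewrite ltr_pMr // expR_gt1.
  apply: le_trans (H _ zx); rewrite /f mulr_suml; apply: ler_sum => k _.
  have -> : alpha * expR x * n%:R = alpha * n%:R * expR x by ring.
  rewrite [leRHS]powRM ?expR_ge0 ?mulr_ge0 ?(ltW al0) // ler_wpM2l ?powR_ge0 //.
  rewrite -expRM; apply: le_trans (expR_ge1Dx _).
  have h : a k <= A.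
    rewrite /A (bigD1 k) //=; apply: le_trans (ler_norm _) _.
    by rewrite lerDl sumr_ge0.
  nra.
rewrite leNgt; apply/negP => cf.
(* Small enough that [A * f * x < f - c0], which contradicts [K]. *)
pose x := (f - c0) / (2 * (A * f + 1)).
have B0 : 0 < A * f + 1 by rewrite ltr_wpDl // mulr_ge0.
have x0 : 0 < x by rewrite /x divr_gt0 ?subr_gt0 // mulr_gt0.
have xE : x * (2 * (A * f + 1)) = f - c0 by rewrite /x mulfVK // gt_eqF // mulr_gt0.
have Kx := K x x0; have P0 : 0 <= A * f * x by exact: mulr_ge0 (mulr_ge0 A0 f0) (ltW x0).
have fin (f' c A' x' : R) : x' * (2 * (A' * f' + 1)) = f' - c -> f' * (1 - A' * x') <= c ->
    0 <= A' * f' * x' -> 0 < x' -> False by lra.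
exact: fin xE Kx P0 x0.
Qed.

End Alpha.

Lemma prod_1D_le_expR (R : realType) (I : finType) (f : I -> R) (C : R) : 3 <= C ->
  (forall i, 0 <= f i) -> \prod_i (1 + 3 * f i) <= expR (C * \sum_i f i).
Proof.
move=> C3 f0; rewrite mulr_sumr expR_sum; apply: ler_prod => i _.
rewrite addr_ge0 ?mulr_ge0 //=; apply: le_trans (expR_ge1Dx _).
by rewrite lerD2l ler_wpM2r.
Qed.

(** * Limits in n *)

Section Asymptotics.
Variables (R : realType) (q : nat -> nat) (r sigma2 : nat -> R)
  (mu : forall n : nat, {ffun 'I_n -> 'Z_(q n)} -> R) (eps : R).
Arguments mu : clear implicits.
Hypothesis walk : forall n, walk_setup (r n) (sigma2 n) (mu n).
Hypothesis eps01 : 0 < eps < 1.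

Let q0 n : 0 < (q n)%:R :> R.
Proof. by case: (walk n) => -[q1 _ _ _ _] _; rewrite ltr0n (ltn_trans _ q1). Qed.

Lemma ln_natr_large (A : R) : \forall n \near \oo, A <= ln n%:R.
Proof.
near=> n; have h : expR A <= n%:R by near: n; exact: nbhs_infty_ger.
by rewrite -(expRK A) ler_ln ?posrE ?expR_gt0 // (lt_le_trans _ h) // expR_gt0.
Unshelve. all: by end_near. Qed.

Lemma tmix_lower_bound :
  (ln (n%:R : R) * offdiag_max (corrY (mu n))) @[n --> \oo] --> 0 ->
  (ln (n%:R : R) * r n ^+ 2 / (q n)%:R ^+ 2) @[n --> \oo] --> 0 ->
  \forall n \near \oo,
     n%:R * (q n)%:R ^+ 2 / (4 * pi ^+ 2 * sigma2 n)
       * (ln n%:R + ln ((eps^-1 - 1) / 5)) <= tmix (mu n) eps.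
Proof.
move=> H1 H2; have /andP[e0 e1] := eps01.
set c := (eps^-1 - 1) / 5; pose lam := ln (1 + (1 - eps) / 10).
have lam0 : 0 < lam by apply: ln_gt0; lra.
pose P := 1 + pi ^+ 2 / 3 : R.
have P1 : 1 <= P by rewrite lerDl divr_ge0 // sqr_ge0.
pose C := 1 + `|ln c|; have C1 : 1 <= C by rewrite lerDl.
have PC1 : 1 <= P * C by rewrite -[1]mulr1 ler_pM.
(* [P] collects the two error terms [o] and [k], and [C] bounds [ln n + ln c] by [C * ln n] once
   [ln n >= 1]. The minimum with 1 also yields [k <= 1]. *)
pose eta := Num.min lam 1 / (P * C).
have eta0 : 0 < eta.
  by rewrite divr_gt0 ?lt_min ?lam0 //= (lt_le_trans ltr01 PC1).
near=> n.
have L1 : 1 <= ln (n%:R : R) by near: n; exact: ln_natr_large.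
have O1 : ln n%:R * offdiag_max (corrY (mu n)) <= eta by near: n; exact: cvgr_le H1 _ eta0.
have K1 : ln n%:R * r n ^+ 2 / (q n)%:R ^+ 2 <= eta by near: n; exact: cvgr_le H2 _ eta0.
have n0 : (0 < n)%N by rewrite lt0n; apply/eqP => n0; move: L1; rewrite n0 ln0 // ler10.
set o := offdiag_max _ in O1 *; pose x := r n ^+ 2 / (q n)%:R ^+ 2.
have x0 : 0 <= x by rewrite divr_ge0 ?sqr_ge0.
have o0 : 0 <= o by exact: bigmax_ge_id.
pose k := pi ^+ 2 / 3 * x.
have k0 : 0 <= k by rewrite /k mulr_ge0 // divr_ge0 // sqr_ge0.
have ok : (o + k) * ln n%:R <= eta * P.
  have -> : (o + k) * ln n%:R = ln n%:R * o + pi ^+ 2 / 3 * (ln n%:R * r n ^+ 2 / (q n)%:R ^+ 2).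
    by rewrite /k /x; ring.
  rewrite /P mulrDr mulr1; apply: lerD => //; rewrite mulrC; apply: ler_wpM2r K1.
  by rewrite divr_ge0 // sqr_ge0.
have okC : (o + k) * (ln n%:R + ln c) <= Num.min lam 1.
  have -> : Num.min lam 1 = eta * P * C by rewrite /eta -mulrA mulfVK // gt_eqF // (lt_le_trans ltr01 PC1).
  apply: (@le_trans _ _ ((o + k) * (ln n%:R * C))).
    rewrite ler_wpM2l ?addr_ge0 // /C mulrDr mulr1 lerD2l; apply: le_trans (ler_norm _) _.
    by rewrite ler_peMl.
  by rewrite mulrA; apply: ler_wpM2r ok; exact: le_trans ler01 C1.
have k1 : k <= 1.
  apply: (@le_trans _ _ ((o + k) * ln n%:R)).
    apply: (@le_trans _ _ (o + k)); first by rewrite lerDr.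
    by rewrite ler_peMr // addr_ge0.
  apply: (le_trans ok); apply: (@le_trans _ _ (eta * P * C)).
    by rewrite ler_peMr // mulr_ge0 ?(ltW eta0) // (le_trans ler01 P1).
  by rewrite /eta -mulrA mulfVK ?gt_eqF ?(lt_le_trans ltr01 PC1) // ge_min lexx orbT.
have [[q1 _ _ [mu0 mu1] musym] [gen _ _ _]] := walk n.
apply: lb_le_inf.
  by have [t t0 dt] := dist_small q1 mu0 mu1 musym gen e0; exists t.
move=> t [t0 dt]; apply: (dist_le_lower_bound (walk n) t0 k1 (o := o)) => //.
  move=> i j ij; rewrite /o /offdiag_max; apply: le_trans (le_bigmax _ _ i).
  exact: le_bigmax_cond.
by apply: (le_trans okC); rewrite ge_min lexx.
Unshelve. all: by end_near. Qed.

Variable g : R -> R.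
Hypothesis decay : decay_condition q sigma2 mu.
Hypothesis corr : corr_condition (fun n => corrY (mu n)) g.
Hypothesis r_cvg : (r n ^+ 2 / (q n)%:R) @[n --> \oo] --> 0.

Let Psi n := invmx (corrY (mu n)).
Let S := sup (range (fun n => mxmaxnorm (Psi n))).

Lemma Psi_bounded : has_ubound (range (fun n => mxmaxnorm (Psi n))).
Proof.
have [[_ [B HB] _ _ _] _] := corr; exists `|B| => _ [n _ <-].
apply: bigmax_le => // a _; apply: bigmax_le => // b _.
exact: le_trans (HB n a b) (ler_norm B).
Qed.

Lemma mxmaxnorm_le_S n : mxmaxnorm (Psi n) <= S.
Proof. by apply: (ub_le_sup Psi_bounded); exists n. Qed.

Lemma Psi_le_S n (a b : 'I_n) : Psi n a b <= S.
Proof.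
apply: le_trans (mxmaxnorm_le_S n); apply: le_trans (ler_norm _) _.
by rewrite /mxmaxnorm; apply: le_trans (le_bigmax _ _ a); exact: le_bigmax.
Qed.

(* Already [n = 1] contributes [Psi = 1]. *)
Lemma S_ge1 : 1 <= S.
Proof.
have [[U _ _ _ _] _] := corr.
apply: le_trans (@Psi_le_S 1 ord0 ord0).
have /matrixP/(_ ord0 ord0) := mulmxV (U 1%N).
by rewrite !mxE big_ord1 (corrY_diag (walk 1)) mul1r mulr1n => ->.
Qed.

Let E := [set z : R | 1 <= z /\ expR ((2 + S) * g z) - 1 <= 4 * eps ^+ 2].
Let alpha := inf E.

Let c0 := ln (1 + 4 * eps ^+ 2) / (2 + S).

Let eps2_gt0 : 0 < 4 * eps ^+ 2.
Proof. by have /andP[e0 _] := eps01; rewrite mulr_gt0 // exprn_gt0. Qed.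

Let S2_gt0 : 0 < 2 + S.
Proof. by rewrite addr_gt0 // (lt_le_trans ltr01 S_ge1). Qed.

Lemma in_alpha_set z : E z <-> 1 <= z /\ g z <= c0.
Proof.
have e4 : 0 < 1 + 4 * eps ^+ 2 by rewrite addr_gt0.
rewrite /E /=; suff -> : (expR ((2 + S) * g z) - 1 <= 4 * eps ^+ 2) = (g z <= c0) by [].
by rewrite lerBlDl -{1}(lnK e4) ler_expR /c0 ler_pdivlMr // mulrC.
Qed.

Lemma alpha_set_nonempty : E !=set0.
Proof.
have [[_ _ _ _ g_cvg] _] := corr.
have c00 : 0 < c0 by rewrite divr_gt0 // ln_gt0 // ltrDl.
have : \forall z \near +oo, 1 <= z /\ g z <= c0.
  by apply: filterS2 (nbhs_pinfty_ge (num_real 1)) (cvgr_le _ g_cvg _ c00) => z.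
move=> /filter_ex [z Hz]; exists z; exact/in_alpha_set.
Qed.

Lemma alpha_ge1 : 1 <= alpha.
Proof. by apply: lb_le_inf; [exact: alpha_set_nonempty | move=> z []]. Qed.

(* [g] need not be right-continuous at [alpha], but each sum it dominates is. *)
Lemma powR_sum_alpha_le n : (0 < n)%N ->
  \sum_k powR (alpha * n%:R) (- schur_a (Psi n) k) <= c0.
Proof.
move=> n0; have [[_ _ gmono _ _] gsum] := corr.
apply: powR_sum_right_continuous => // [|z az]; first exact: lt_le_trans alpha_ge1.
have [y /in_alpha_set[y1 gy] yz] := inf_lt alpha_set_nonempty az.
have z1 : 1 <= z by rewrite (le_trans y1) // ltW.
apply: le_trans (gsum z z1 n) _; apply: le_trans gy.
exact: gmono y1 (ltW yz).
Qed.

Let time n := n%:R * (q n)%:R ^+ 2 * ln (alpha * n%:R) / (4 * pi ^+ 2 * sigma2 n)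
   * (1 - r n ^+ 2 / (12 * (q n)%:R))^-1.

Let time0 n := n%:R * (q n)%:R ^+ 2 * ln n%:R / (4 * pi ^+ 2 * sigma2 n).

(* The Decay Condition asks for the lower bound at every [n], which [time] satisfies
   only when [r ^ 2 < 12 q]. *)
Let time1 n := if r n ^+ 2 / (12 * (q n)%:R) < 1 then time n else time0 n.

Lemma time0_le_time1 n : time0 n <= time1 n.
Proof.
rewrite /time1; case: ifP => // x1; rewrite /time0 /time.
have [->|n0] := posnP n; first by rewrite !mul0r.
have nR : 1 <= n%:R :> R by rewrite ler1n.
have [[_ _ s0 _ _] _] := walk n.
have D0 : 0 <= (4 * pi ^+ 2 * sigma2 n)^-1.
  by rewrite invr_ge0 mulr_ge0 ?(ltW s0) // mulr_ge0 // sqr_ge0.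
have A0 : 0 <= n%:R * (q n)%:R ^+ 2 :> R by rewrite mulr_ge0 // sqr_ge0.
have L : ln n%:R <= ln (alpha * n%:R).
  have n1 : 0 < n%:R :> R by rewrite (lt_le_trans ltr01).
  by rewrite ler_ln ?posrE ?mulr_gt0 ?(lt_le_trans ltr01 alpha_ge1) // ler_peMl ?alpha_ge1 // ltW.
have L0 : 0 <= ln (n%:R : R) by exact: ln_ge0.
apply: (@le_trans _ _ (n%:R * (q n)%:R ^+ 2 * ln (alpha * n%:R) / (4 * pi ^+ 2 * sigma2 n))).
  by rewrite ler_wpM2r // ler_wpM2l.
rewrite ler_peMr //; first by rewrite mulr_ge0 // mulr_ge0 // (le_trans L0).
rewrite invf_ge1 ?subr_gt0 // lerBlDr lerDl divr_ge0 ?sqr_ge0 // mulr_ge0 //.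
Qed.

Lemma dist_upper_bound :
  exists e : nat -> R, e n @[n --> \oo] --> 0 /\
     \forall n \near \oo, dist (mu n) (time n) <= eps + e n.
Proof.
have /andP[e0 _] := eps01.
pose A n : R := \sum_(x : {ffun 'I_n -> 'Z_(q n)} | far R x)
  expR (2 * time1 n * (charfun (mu n) (fun i => 2 * pi * repR R (x i) / (q n)%:R) - 1)).
have A_cvg : A n @[n --> \oo] --> 0 by exact: decay time0_le_time1.
(* The far part separates from [eps] through [sqrt (A + 4 eps^2) <= sqrt A + 2 eps]. *)
exists (fun n => 2^-1 * Num.sqrt (A n)); split.
  rewrite -(mulr0 2^-1) -[X in _ * X](sqrtr0 R); apply: cvgMl_tmp.
  by apply: (cvg_comp A (@Num.sqrt R) A_cvg); exact: sqrt_continuous.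
near=> n.
(* Since a_k >= 1 / S, this puts each exponent [l * a_k] above the threshold 32 of [theta_bound]. *)
have Ln : 32 * S <= ln n%:R by near: n; exact: ln_natr_large.
have rq : r n ^+ 2 / (q n)%:R < 12 by near: n; apply: (cvgr_lt _ r_cvg).
have S1 := S_ge1.
have n0 : (0 < n)%N.
  by rewrite lt0n; apply/eqP => n0; move: Ln; rewrite n0 ln0 //; lra.
have x1 : r n ^+ 2 / (12 * (q n)%:R) < 1.
  by rewrite ltr_pdivrMr ?mulr_gt0 // mul1r -ltr_pdivrMr.
have T1 : time1 n = time n by rewrite /time1 x1.
have alpha1 := alpha_ge1.
have nR : 0 < n%:R :> R by rewrite ltr0n.
have al0 : 0 < alpha by rewrite (lt_le_trans ltr01).
have anR : 0 < alpha * n%:R by rewrite mulr_gt0.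
pose l := ln (alpha * n%:R).
have lS : 32 * S <= l.
  by apply: le_trans Ln _; rewrite ler_ln ?posrE // ler_peMl // ltW.
have l0 : 0 <= l by apply: le_trans lS; lra.
have gauss : \prod_k (1 + 3 * expR (- (l * schur_a (Psi n) k))) - 1 <= 4 * eps ^+ 2.
  rewrite lerBlDl; apply: le_trans (prod_1D_le_expR (C := 2 + S) _ _) _ => //; first lra.
  have e4 : 0 < 1 + 4 * eps ^+ 2 by rewrite addr_gt0.
  rewrite -[leRHS](lnK e4) ler_expR mulrC -ler_pdivlMr //.
  apply: le_trans (powR_sum_alpha_le n0); apply: ler_sum => k _.
  by rewrite /powR gt_eqF // mulNr mulrC.
have large k : 32 <= l * schur_a (Psi n) k.
  have [[U _ _ _ _] _] := corr.
  have Sk : 0 < schur_a (Psi n) k /\ S^-1 <= schur_a (Psi n) k.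
    move: k; rewrite /Psi; have := U n; have := walk n; have := @Psi_le_S n; rewrite /Psi.
    (* The results on quadratic forms are stated in dimension [n.+1], so everything depending on [n]
       is generalised before the case split. *)
    case: (n) n0 (mu n) => // m _ mum PS wm Um k.
    have Gsym : (corrY mum)^T = corrY mum by apply/matrixP => i j; rewrite mxE corrY_sym.
    have [p0 pa] := schur_a_ge Gsym Um (quad_corrY_gt0 wm Um) k.
    have S0 : 0 < S by rewrite (lt_le_trans ltr01).
    split; first by apply: lt_le_trans pa; rewrite invr_gt0.
    by apply: le_trans pa; rewrite lef_pV2 ?posrE.
  have S0 : 0 < S by rewrite (lt_le_trans ltr01).
  apply: (@le_trans _ _ (l * S^-1)); first by rewrite ler_pdivlMr.
  by rewrite ler_wpM2l // Sk.2.
have main : dist (mu n) (time n) <= 2^-1 * Num.sqrt (A n +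
   (\prod_k (1 + 3 * expR (- (l * schur_a (Psi n) k))) - 1)).
  have [[U _ _ _ _] _] := corr.
  rewrite /A T1 /time -/l; move: large x1; rewrite /Psi; have := U n; have := walk n.
  case: (n) n0 (mu n) => // m _ mum wm Um lm xm.
  exact: (dist_le_far_gaussian wm Um l0 lm xm).
apply: (le_trans main).
have A0 : 0 <= A n by apply: sumr_ge0 => w _; exact: expR_ge0.
apply: (@le_trans _ _ (2^-1 * (Num.sqrt (A n) + 2 * eps))); last by lra.
rewrite ler_wpM2l //.
have sA := sqrtr_ge0 (A n).
have B0 : 0 <= Num.sqrt (A n) + 2 * eps by rewrite addr_ge0 // mulr_ge0 // ltW.
rewrite -[leRHS](ger0_norm B0) -sqrtr_sqr ler_wsqrtr // sqrrD sqr_sqrtr //.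
have : 0 <= Num.sqrt (A n) * (2 * eps) by rewrite mulr_ge0 // mulr_ge0 // ltW.
by rewrite exprMn mulr2n; lra.
Unshelve. all: by end_near. Qed.

End Asymptotics.

Theorem theorem3 (R : realType) (q : nat -> nat) (r sigma2 : nat -> R)
  (mu : forall n : nat, {ffun 'I_n -> 'Z_(q n)} -> R) (eps : R) :
  (forall n, walk_setup (r n) (sigma2 n) (mu n)) ->
  0 < eps < 1 ->
  (* part (a) *)
  (forall g : R -> R,
     decay_condition q sigma2 mu ->
     corr_condition (fun n => corrY (mu n)) g ->
     ((q n)%:R : R) @[n --> \oo] --> +oo ->
     (r n ^+ 2 / (q n)%:R) @[n --> \oo] --> 0 ->
     let S := sup (range (fun n => mxmaxnorm (invmx (corrY (mu n))))) in
     let alpha := inf [set z : R | 1 <= z /\ expR ((2 + S) * g z) - 1 <= 4 * eps ^+ 2] in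
     let t := fun n : nat =>
       n%:R * (q n)%:R ^+ 2 * ln (alpha * n%:R) / (4 * pi ^+ 2 * sigma2 n)
         * (1 - r n ^+ 2 / (12 * (q n)%:R))^-1 in
     exists e : nat -> R, e n @[n --> \oo] --> 0 /\
       \forall n \near \oo, dist (mu n) (t n) <= eps + e n)
  /\
  (* part (b) *)
  (((q n)%:R : R) @[n --> \oo] --> +oo ->
   (ln (n%:R : R) * offdiag_max (corrY (mu n))) @[n --> \oo] --> 0 ->
   (ln (n%:R : R) * r n ^+ 2 / (q n)%:R ^+ 2) @[n --> \oo] --> 0 ->
   \forall n \near \oo,
     n%:R * (q n)%:R ^+ 2 / (4 * pi ^+ 2 * sigma2 n)
       * (ln n%:R + ln ((eps^-1 - 1) / 5)) <= tmix (mu n) eps).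
Proof.
move=> walk eps01; split.
  move=> g decay corr _ r_cvg S alpha t.
  exact: (dist_upper_bound walk eps01 decay corr r_cvg).
by move=> _; exact: tmix_lower_bound.
Qed.
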